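(* A pair $(C,L)$ consisting of a cubic curve $C$ and a line $L$ on $\mathbb{P}^2$ is unstable if and only if one of the following is true: (i) $L$ is a triple tangent to $C$; (ii) $L$ is contained in $C$; (iii) $L$ passes through a double point of $C$; (iv) $C$ has a triple point; (v) $C$ is nonreduced.
   Context: Let $k$ be an algebraically closed field of characteristic not $2$ or $3$, $\mathbb{P}^2=\mathrm{Proj}\,k[x_0,x_1,x_2]$, $V^\vee=k[x_0,x_1,x_2]_1$. Pairs $(C,L)=(V(F),V(S))$ with $F$ a nonzero cubic form and $S$ a nonzero linear form are points of $\mathbb{P}(S^3V)\times\mathbb{P}(V)\simeq\mathbb{P}^9\times\mathbb{P}^2$, on which $\mathrm{PGL}(3)$ acts by $g\cdot(V(F(x)),V(S(x)))=(V(F(g^{-1}x)),V(S(g^{-1}x)))$. Semistability is in the sense of geometric invariant theory, with respect to the $\mathrm{SL}(3)$-linearized bundle $\mathcal{O}(1,1)$ (pulled back from $\mathbb{P}(S^3V\otimes V)$ via the Segre embedding); unstable means not semistable. $L$ is a triple tangent to $C$ if $L\not\subset C$ and $L$ meets $C$ in a single point with multiplicity $3$; a double (triple) point of $C$ is a point of multiplicity $2$ (resp. $3$) on $C$. *)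

(* Defs.v *)
From HB Require Import structures.
From mathcomp Require Import all_boot all_order all_algebra.
From mathcomp Require Import mpoly.

Set Implicit Arguments.
Unset Strict Implicit.
Unset Printing Implicit Defensive.

Import GRing.Theory.
Local Open Scope ring_scope.

(* Points of P^2 are given by nonzero vectors p : 'rV[k]_3, curves and lines
   by nonzero forms; both are homogeneous coordinates, and every notion below
   is invariant under rescaling them. *)

Section Geometry.
Variable k : fieldType.
Implicit Types (F S : {mpoly k[3]}) (p q : 'rV[k]_3).

Definition on_curve F p : bool := F.@[p 0] == 0.

Definition same_point p q : Prop := exists2 c : k, c != 0 & q = c *: p.

Definition line_in_curve F S : Prop :=
  forall p, p != 0 -> on_curve S p -> on_curve F p.

(* t |-> F(p + t q), the restriction of F to the line through p and q in the
   affine coordinate t centred at p. *)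
Definition restrict_to_line F p q : {poly k} :=
  mmap polyC (fun i => (p 0 i)%:P + (q 0 i) *: 'X) F.

(* The intersection multiplicity of V(F) and the line V(S) at p is m: the
   order of vanishing at p of the restriction of F to V(S); it does not depend
   on the second point q of V(S).  Meaningful when V(S) is not contained in
   V(F), so that the restriction is nonzero. *)
Definition line_intersection_mult F S p (m : nat) : Prop :=
  exists q, [/\ q != 0, on_curve S q, ~ same_point p q
              & mup 0 (restrict_to_line F p q) = m].

Definition triple_tangent F S : Prop :=
  ~ line_in_curve F S /\
  exists p,
    [/\ p != 0, on_curve S p && on_curve F p,
        (forall p', p' != 0 -> on_curve S p' && on_curve F p' ->
                    same_point p p')
      & line_intersection_mult F S p 3].

(* Equation of V(F) in the chart x_i = 1, the two remaining coordinates being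
   taken in increasing order. *)
Definition dehomogenize (i : 'I_3) F : {mpoly k[2]} :=
  F \mPo [tuple if unlift i l is Some j then 'X_j else 1 | l < 3].

Definition mpoly_order n (f : {mpoly k[n]}) : nat :=
  \big[minn/msize f]_(m <- msupp f) mdeg m.

(* Order at the origin of the affine equation of V(F), translated to p, in a
   chart containing p (any such chart gives the same value). *)
Definition multiplicity F p : nat :=
  if [pick i | p 0 i != 0] is Some i then
    mpoly_order
      (dehomogenize i F \mPo
         [tuple 'X_j + (p 0 (lift i j) / p 0 i)%:MP | j < 2])
  else 0.

Definition line_through_double_point F S : Prop :=
  exists p, [/\ p != 0, on_curve S p & multiplicity F p = 2].

Definition has_triple_point F : Prop :=
  exists p, p != 0 /\ multiplicity F p = 3.

(* The scheme V(F) is covered by the affine schemes Spec k[y_0, y_1]/(f_i),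
   f_i = dehomogenize i F; it is nonreduced iff one of these rings has a
   nonzero nilpotent, here the class of h. *)
Definition nonreduced F : Prop :=
  exists (i : 'I_3) (h : {mpoly k[2]}),
    (exists (n : nat) (g : {mpoly k[2]}), h ^+ n = dehomogenize i F * g) /\
    ~ (exists g : {mpoly k[2]}, h = dehomogenize i F * g).

End Geometry.

Section GIT.
Variable k : fieldType.
Implicit Types (F S : {mpoly k[3]}) (P : {mpoly k[10 + 3]}).

(* (g . F)(x) = F (g^-1 x), x a column vector. *)
Definition act_form (g : 'M[k]_3) F : {mpoly k[3]} :=
  F \mPo [tuple \sum_(j < 3) (invmx g) i j *: 'X_j | i < 3].

Definition cubic_monomials : 10.-tuple 'X_{1..3} :=
  [tuple [multinom [tuple 3; 0; 0]];
         [multinom [tuple 0; 3; 0]];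
         [multinom [tuple 0; 0; 3]];
         [multinom [tuple 2; 1; 0]];
         [multinom [tuple 2; 0; 1]];
         [multinom [tuple 1; 2; 0]];
         [multinom [tuple 0; 2; 1]];
         [multinom [tuple 1; 0; 2]];
         [multinom [tuple 0; 1; 2]];
         [multinom [tuple 1; 1; 1]]]%N.

(* Coordinates on (cubic forms) x (linear forms): the coefficients. *)
Definition pair_coords F S (l : 'I_(10 + 3)) : k :=
  match split l with
  | inl i => F@_(tnth cubic_monomials i)
  | inr j => S@_(U_(j)%MM)
  end.

(* Global sections of O(a,b) on P^9 x P^2. *)
Definition bihomogeneous (a b : nat) P : Prop :=
  forall m, m \in msupp P ->
    (\sum_(i < 10) m (lshift 3 i) = a)%N /\
    (\sum_(j < 3) m (rshift 10 j) = b)%N.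

(* Invariance under SL(3), acting on O(n,n) through its linear action on the
   spaces of cubic and linear forms. *)
Definition SL3_invariant P : Prop :=
  forall g : 'M[k]_3, \det g = 1 ->
  forall F S, F \is 3.-homog -> S \is 1.-homog ->
    P.@[pair_coords (act_form g F) (act_form g S)] = P.@[pair_coords F S].

(* Mumford's definition for the linearized bundle O(1,1): some invariant
   section of a positive power O(n,n) does not vanish at the point.  The
   nonvanishing locus of such a section is automatically affine because O(1,1)
   is ample.  Intended for k algebraically closed, so that invariance may be
   tested on k-points. *)
Definition semistable F S : Prop :=
  exists (n : nat) (P : {mpoly k[10 + 3]}),
    [/\ (0 < n)%N, bihomogeneous n n P, SL3_invariant P
      & P.@[pair_coords F S] != 0].

Definition unstable F S : Prop := ~ semistable F S.

End GIT.

(* Main.v *)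
(* Semistability is detected by four invariant sections built from classical
   concomitants of a cubic F and a line u: the Cayleyan P, of bidegree (3,3),
   and products of powers of the dual form (the discriminant of F restricted to
   u) with P polarized once by the Hessian H, with the dual form of H, and with
   the dual form of H polarized once by F.  All of them are expressed through
   the polarized determinant of 3x3 matrices, which makes their equivariance
   under GL(3) immediate.  If they all vanish, a basis adapted to the line, in
   which the binary cubic F|u is x^3 + y^3 or has a double root, shows that
   either F|u is a cube (possibly zero), or F is singular at a point of u, or F
   has a triple point.  In each of these cases an explicit diagonal
   one-parameter subgroup destabilizes the pair.

   If none of these cases occurs, some point o off the curve lies on a line
   meeting the curve in three distinct points.  Then F is, up to a unit, a monic
   cubic in one variable over the pencil of lines through o, with nonzero
   discriminant, so F divides every form one of whose powers it divides, and the
   curve is reduced. *)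

Require Import Defs.
From HB Require Import structures.
From mathcomp Require Import all_boot all_order all_algebra.
From mathcomp Require Import mpoly.
From mathcomp Require Import ring.

Set Implicit Arguments.
Unset Strict Implicit.
Unset Printing Implicit Defensive.

Import GRing.Theory.
Local Open Scope ring_scope.

(** * Mixed determinants and covariants of ternary cubics *)

(** The hard direction would usually call on the Hilbert-Mumford criterion. Here sections with
    explicitly solvable common zeros replace it, and one-parameter subgroups serve only to prove
    instability. A section of O(n,n) must have equal degrees in F and u. The Cayleyan has this by
    itself; the other three concomitants have a degree in F that is too large by 2, 6 and 4, and the
    dual form, of bidegree (4,6), makes up the excess with its powers 1, 3 and 2. When F|u is a sum
    of two nonzero cubes the dual form is nonzero, so these factors lose no information; where it
    vanishes, the Cayleyan suffices. The concomitants are defined over an arbitrary commutative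
    ring: at the generic pair they become polynomials in the 13 coefficients, and their bidegrees
    follow from scaling the generic pair by powers of a new variable. *)

Notation o0 := (@Ordinal 3 0 isT).
Notation o1 := (@Ordinal 3 1 isT).
Notation o2 := (@Ordinal 3 2 isT).

Lemma big_ord3 (V : nmodType) (f : 'I_3 -> V) :
  \sum_(i < 3) f i = f o0 + f o1 + f o2.
Proof.
rewrite !big_ord_recr big_ord0 /= add0r.
by congr (f _ + f _ + f _); apply: val_inj.
Qed.

Lemma forall_ord3 (Q : 'I_3 -> Prop) : Q o0 -> Q o1 -> Q o2 -> forall i, Q i.
Proof.
move=> q0 q1 q2 [[|[|[|//]]] lt_i3].
- by rewrite (_ : Ordinal lt_i3 = o0) //; apply: val_inj.
- by rewrite (_ : Ordinal lt_i3 = o1) //; apply: val_inj.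
- by rewrite (_ : Ordinal lt_i3 = o2) //; apply: val_inj.
Qed.

Section MixedDeterminant.
Variable R : comNzRingType.
Implicit Types (M N K E : 'M[R]_3).

Lemma det_mx33 M :
  \det M = M o0 o0 * (M o1 o1 * M o2 o2 - M o1 o2 * M o2 o1)
         - M o0 o1 * (M o1 o0 * M o2 o2 - M o1 o2 * M o2 o0)
         + M o0 o2 * (M o1 o0 * M o2 o1 - M o1 o1 * M o2 o0).
Proof.
rewrite (expand_det_row _ o0) big_ord3 /cofactor.
have det2 (N : 'M[R]_2) : \det N = N 0 0 * N 1 1 - N 0 1 * N 1 0.
  rewrite (expand_det_row _ 0) !big_ord_recl big_ord0 /cofactor !det_mx11 !mxE /=.
  rewrite (_ : lift 0 0 = 1); last exact: val_inj.
  rewrite (_ : lift 1 0 = 0); last exact: val_inj.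
  by rewrite /=; ring.
rewrite !det2 !mxE.
rewrite (_ : lift o0 0 = o1); last exact: val_inj.
rewrite (_ : lift o0 1 = o2); last exact: val_inj.
rewrite (_ : lift o1 0 = o0); last exact: val_inj.
rewrite (_ : lift o1 1 = o2); last exact: val_inj.
rewrite (_ : lift o2 0 = o0); last exact: val_inj.
rewrite (_ : lift o2 1 = o1); last exact: val_inj.
rewrite /=; ring.
Qed.

(** The full polarization of [\det], by inclusion and exclusion: symmetric and trilinear, equal to 6
    times [\det M] on the diagonal, and free of division. *)
Definition mixed_det M N K : R :=
  \det (M + N + K) - \det (M + N) - \det (M + K) - \det (N + K)
  + \det M + \det N + \det K.

Lemma mixed_detC M N K : mixed_det M N K = mixed_det N M K.
Proof. by rewrite /mixed_det (addrC N M); ring. Qed.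

Lemma mixed_detAC M N K : mixed_det M N K = mixed_det M K N.
Proof. by rewrite /mixed_det (addrAC M N K) (addrC N K); ring. Qed.

Lemma mixed_det_linear M N K M' c :
  mixed_det (c *: M + M') N K = c * mixed_det M N K + mixed_det M' N K.
Proof. by rewrite /mixed_det !det_mx33 !mxE; ring. Qed.

Lemma mixed_detZ c M N K : mixed_det (c *: M) N K = c * mixed_det M N K.
Proof. by rewrite -[c *: M]addr0 mixed_det_linear /mixed_det !add0r det0; ring. Qed.

Lemma mixed_det_suml (c : 'I_3 -> R) (A : 'I_3 -> 'M[R]_3) N K :
  mixed_det (\sum_i c i *: A i) N K = \sum_i c i * mixed_det (A i) N K.
Proof.
rewrite !big_ord3 -addrA mixed_det_linear mixed_det_linear.
by rewrite -[c o2 *: A o2]addr0 mixed_det_linear /mixed_det !add0r det0; ring.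
Qed.

(** A congruence multiplies each of the seven determinants by [\det E ^+ 2]. Together with
    [cross_contract] this produces every weight below. *)
Lemma mixed_det_congr E M N K :
  mixed_det (E *m M *m E^T) (E *m N *m E^T) (E *m K *m E^T)
  = \det E ^+ 2 * mixed_det M N K.
Proof.
rewrite /mixed_det -!mulmxDl -!mulmxDr !det_mulmx !det_tr; ring.
Qed.

End MixedDeterminant.

(** Third derivatives of a cubic, stored as three slices so that [mixed_det] applies to them;
    [symmetric_tensor] records the symmetry separately. *)
Definition tensor (R : comNzRingType) := 'I_3 -> 'M[R]_3.

Lemma exchange4 (V : nmodType) n (f : 'I_n -> 'I_n -> 'I_n -> 'I_n -> V) :
  \sum_b \sum_t \sum_a \sum_c f b t a c = \sum_a \sum_c \sum_b \sum_t f b t a c.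
Proof.
under eq_bigr => b _ do rewrite exchange_big.
rewrite exchange_big; apply: eq_bigr => a _ /=.
under eq_bigr => b _ do rewrite exchange_big.
by rewrite exchange_big.
Qed.

Section Covariants.
Variable R : comNzRingType.
Implicit Types (E : 'M[R]_3) (d e : tensor R) (u : 'cV[R]_3).

(* The tensor d in the basis given by the rows of E. *)
Definition act E d : tensor R := fun i => E *m (\sum_a E i a *: d a) *m E^T.

(** Since [\sum_i x_i *: d i] is the matrix of second derivatives of the cubic, these are the third
    derivatives of its determinant. *)
Definition hessian d : tensor R :=
  fun i => \matrix_(j, k) mixed_det (d i) (d j) (d k).

(* Symbolically (abu)^2 a_x b_x. *)
Definition bordered d e u : 'M[R]_3 :=
  \matrix_(k, l) mixed_det (d k) (e l) (u *m u^T).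

(* For d = e = d' = e' this is, up to a factor, the discriminant of the
   restriction of the cubic to the line u. *)
Definition dual_form d e d' e' u : R :=
  mixed_det (bordered d e u) (bordered d' e' u) (u *m u^T).

(* The entry (i, k) is det (e_i, e_k, u). *)
Definition cross u : 'M[R]_3 :=
  \matrix_(i, k) nth 0 (nth [::] [:: [:: 0; u o2 0; - u o1 0];
                                     [:: - u o2 0; 0; u o0 0];
                                     [:: u o1 0; - u o0 0; 0]] i) k.

(* Symbolically (abc)(abu)(acu)(bcu), with a, b taken from d and c from e. *)
Definition cayleyan d e u : R :=
  \sum_i \sum_k cross u i k *
    (\sum_j \sum_m cross u j m *
       mixed_det (d i) (d j) (col m (e k) *m u^T)).

Lemma congr_mxE E (M : 'M[R]_3) i j :
  (E *m M *m E^T) i j = \sum_a \sum_b E i a * E j b * M a b.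
Proof.
rewrite mxE exchange_big; apply: eq_bigr => b _.
rewrite !mxE big_distrl; apply: eq_bigr => a _ /=; ring.
Qed.

(** The summation indices are the outer ones of the tensors and transform linearly; the matrix
    indices are absorbed into [\det E ^+ 2]. *)
Lemma mixed_det_congr_sum E (a b c : 'I_3 -> R) (A B C : 'I_3 -> 'M[R]_3) :
  mixed_det (E *m (\sum_i a i *: A i) *m E^T)
            (E *m (\sum_i b i *: B i) *m E^T)
            (E *m (\sum_i c i *: C i) *m E^T)
  = \det E ^+ 2 *
    \sum_i \sum_j \sum_k a i * b j * c k * mixed_det (A i) (B j) (C k).
Proof.
rewrite mixed_det_congr mixed_det_suml; congr (_ * _).
apply: eq_bigr => i _; rewrite mixed_detC mixed_det_suml big_distrr /=.
apply: eq_bigr => j _; rewrite mixed_detC mixed_detAC mixed_detC mixed_det_suml.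
rewrite !big_distrr; apply: eq_bigr => k _ /=.
by rewrite mixed_detC mixed_detAC -!mulrA.
Qed.

Lemma act_entry E d i j k :
  act E d i j k = \sum_a \sum_b \sum_c E i a * E j b * E k c * d a b c.
Proof.
rewrite /act congr_mxE [RHS]exchange_big /=; apply: eq_bigr => b _.
rewrite [RHS]exchange_big /=; apply: eq_bigr => c _.
by rewrite summxE big_distrr; apply: eq_bigr => a _; rewrite !mxE /=; ring.
Qed.

Lemma hessian_act E d i :
  hessian (act E d) i = \det E ^+ 2 *: act E (hessian d) i.
Proof.
apply/matrixP => j k; rewrite [RHS]mxE act_entry mxE mixed_det_congr_sum.
congr (_ * _); apply: eq_bigr => a _; apply: eq_bigr => b _.
by apply: eq_bigr => c _; rewrite mxE.
Qed.

Lemma congr_outer E u : (E *m u) *m (E *m u)^T = E *m (u *m u^T) *m E^T.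
Proof. by rewrite trmx_mul !mulmxA. Qed.

Lemma sum1_delta (A : 'I_3 -> 'M[R]_3) i : A i = \sum_j (i == j)%:R *: A j.
Proof.
rewrite (bigD1 i) //= eqxx scale1r big1 ?addr0 // => j /negbTE ne_ji.
by rewrite eq_sym ne_ji scale0r.
Qed.

Lemma bordered_act E d e u :
  bordered (act E d) (act E e) (E *m u)
  = \det E ^+ 2 *: (E *m bordered d e u *m E^T).
Proof.
apply/matrixP => k l; rewrite [RHS]mxE congr_mxE mxE congr_outer.
(* The constant matrix becomes a sum against a Kronecker delta, the shape that [mixed_det_congr_sum]
   expects. *)
rewrite (sum1_delta (fun=> u *m u^T) o0) mixed_det_congr_sum.
congr (_ * _); apply: eq_bigr => a _; apply: eq_bigr => b _.
by rewrite big_ord3 mxE /= mulr1 !mulr0 !mul0r !addr0.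
Qed.

Lemma dual_form_act E d e d' e' u :
  dual_form (act E d) (act E e) (act E d') (act E e') (E *m u)
  = \det E ^+ 6 * dual_form d e d' e' u.
Proof.
rewrite /dual_form !bordered_act congr_outer mixed_detZ mixed_detC mixed_detZ.
by rewrite mixed_det_congr mixed_detC; ring.
Qed.

(** In matrix form, the transpose of [E] times [cross (E *m u)] times [E] is [\det E *: cross u]:
    both have the entries det (E e_a, E e_c, E u). *)
Lemma cross_contract E u (X : 'I_3 -> 'I_3 -> R) :
  \sum_i \sum_k cross (E *m u) i k * (\sum_a \sum_c E i a * E k c * X a c)
  = \det E * \sum_a \sum_c cross u a c * X a c.
Proof. by rewrite !big_ord3 det_mx33 !mxE !big_ord3 /=; ring. Qed.

(** The weight is 4 = 1 + 1 + 2: one for each of the two factors [cross], two for [mixed_det]. *)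
Lemma cayleyan_act E d e u :
  cayleyan (act E d) (act E e) (E *m u) = \det E ^+ 4 * cayleyan d e u.
Proof.
pose Y a c := \sum_j \sum_m cross u j m *
       mixed_det (d a) (d j) (col m (e c) *m u^T).
transitivity (\sum_i \sum_k cross (E *m u) i k *
    (\sum_a \sum_c E i a * E k c * (\det E ^+ 3 * Y a c))); last first.
  rewrite cross_contract /cayleyan -/Y !big_distrr; apply: eq_bigr => a _ /=.
  by rewrite !big_distrr; apply: eq_bigr => c _ /=; rewrite -[X in _ ^+ 4 * (_ * X)]/(Y a c); ring.
apply: eq_bigr => i _; apply: eq_bigr => k _; congr (_ * _).
transitivity (\sum_j \sum_m cross (E *m u) j m *
    (\sum_b \sum_t E j b * E m t * (\det E ^+ 2 *
      \sum_a \sum_c E i a * E k c * mixed_det (d a) (d b) (col t (e c) *m u^T)))).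
  apply: eq_bigr => j _; apply: eq_bigr => m _; congr (_ * _).
  (* The third matrix is itself a congruence by [E] of a sum in which [m] transforms like an outer
     index, so [mixed_det_congr_sum] applies. *)
  have -> : col m (act E e k) *m (E *m u)^T
      = E *m (\sum_t E m t *: (\sum_c E k c *: (col t (e c) *m u^T))) *m E^T.
    rewrite trmx_mul mulmxA; congr (_ *m _).
    under eq_bigr => t _ do under eq_bigr => c _ do rewrite scalemxAl.
    under eq_bigr => t _ do rewrite -mulmx_suml scalemxAl.
    rewrite -mulmx_suml mulmxA; congr (_ *m _).
    rewrite /act colE -!mulmxA -colE; congr (_ *m _); apply/matrixP => r z.
    rewrite mxE summxE; apply: eq_bigr => t _; rewrite !mxE mulrC !summxE.
    by congr (_ * _); apply: eq_bigr => c _; rewrite !mxE.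
  rewrite mixed_det_congr_sum.
  transitivity (\det E ^+ 2 * \sum_a \sum_b \sum_t E i a * E j b * E m t *
     \sum_c E k c * mixed_det (d a) (d b) (col t (e c) *m u^T)).
    congr (_ * _); apply: eq_bigr => a _; apply: eq_bigr => b _; apply: eq_bigr => t _.
    congr (_ * _); rewrite mixed_detAC mixed_detC mixed_det_suml.
    by apply: eq_bigr => c _; rewrite mixed_detC mixed_detAC.
  rewrite exchange_big big_distrr; apply: eq_bigr => b _ /=.
  rewrite exchange_big big_distrr; apply: eq_bigr => t _ /=.
  rewrite !mulr_sumr; apply: eq_bigr => a _; rewrite !mulr_sumr.
  by apply: eq_bigr => c _; ring.
rewrite cross_contract /Y mulr_sumr.
under eq_bigr => b _.
  rewrite mulr_sumr; under eq_bigr => t _.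
    rewrite !mulr_sumr; under eq_bigr => a _ do rewrite !mulr_sumr.
    over.
  over.
rewrite exchange4; apply: eq_bigr => a _; apply: eq_bigr => c _.
rewrite !mulr_sumr; apply: eq_bigr => b _; rewrite !mulr_sumr.
by apply: eq_bigr => t _; ring.
Qed.

End Covariants.

(** * Homogeneity and base change of the concomitants *)

Definition scale_tensor (R : comNzRingType) (s : R) (d : tensor R) : tensor R :=
  fun i => s *: d i.

Definition map_tensor (R S : comNzRingType) (f : R -> S) (d : tensor R) : tensor S :=
  fun i => map_mx f (d i).

Section Homogeneity.
Variable R : comNzRingType.
Implicit Types (d e : tensor R) (u : 'cV[R]_3) (s t : R).

Lemma mixed_detZZZ (M N K : 'M[R]_3) s t r :
  mixed_det (s *: M) (t *: N) (r *: K) = s * t * r * mixed_det M N K.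
Proof.
rewrite mixed_detZ mixed_detC mixed_detZ mixed_detAC mixed_detC mixed_detZ.
by rewrite mixed_detAC mixed_detC mixed_detAC; ring.
Qed.

Lemma eq_bordered d d' e e' u : d =1 d' -> e =1 e' -> bordered d e u = bordered d' e' u.
Proof. by move=> eqd eqe; apply/matrixP => k l; rewrite !mxE eqd eqe. Qed.

Lemma eq_dual_form d1 d1' d2 d2' d3 d3' d4 d4' u :
  d1 =1 d1' -> d2 =1 d2' -> d3 =1 d3' -> d4 =1 d4' ->
  dual_form d1 d2 d3 d4 u = dual_form d1' d2' d3' d4' u.
Proof.
by move=> eq1 eq2 eq3 eq4; rewrite /dual_form (eq_bordered _ eq1 eq2) (eq_bordered _ eq3 eq4).
Qed.

Lemma eq_cayleyan d d' e e' u : d =1 d' -> e =1 e' -> cayleyan d e u = cayleyan d' e' u.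
Proof.
move=> eqd eqe; apply: eq_bigr => i _; apply: eq_bigr => k _; congr (_ * _).
by apply: eq_bigr => j _; apply: eq_bigr => m _; rewrite !eqd eqe.
Qed.

Lemma eq_hessian d d' : d =1 d' -> hessian d =1 hessian d'.
Proof. by move=> eqd i; apply/matrixP => j k; rewrite !mxE !eqd. Qed.

Lemma scale_outer t u : (t *: u) *m (t *: u)^T = t ^+ 2 *: (u *m u^T).
Proof. by rewrite linearZ /= -scalemxAl -scalemxAr scalerA. Qed.

Lemma hessian_scale s d : hessian (scale_tensor s d) =1 scale_tensor (s ^+ 3) (hessian d).
Proof. by move=> i; apply/matrixP => j k; rewrite !mxE mixed_detZZZ; ring. Qed.

Lemma bordered_scale s1 s2 t d1 d2 u :
  bordered (scale_tensor s1 d1) (scale_tensor s2 d2) (t *: u)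
  = (s1 * s2 * t ^+ 2) *: bordered d1 d2 u.
Proof. by apply/matrixP => k l; rewrite !mxE scale_outer mixed_detZZZ. Qed.

Lemma dual_form_scale s1 s2 s3 s4 t d1 d2 d3 d4 u :
  dual_form (scale_tensor s1 d1) (scale_tensor s2 d2)
            (scale_tensor s3 d3) (scale_tensor s4 d4) (t *: u)
  = s1 * s2 * s3 * s4 * t ^+ 6 * dual_form d1 d2 d3 d4 u.
Proof. by rewrite /dual_form !bordered_scale scale_outer mixed_detZZZ; ring. Qed.

Lemma cross_scale t u : cross (t *: u) = t *: cross u.
Proof.
apply/matrixP; apply: forall_ord3; apply: forall_ord3; rewrite !mxE /=; ring.
Qed.

Lemma cayleyan_scale s1 s2 t d e u :
  cayleyan (scale_tensor s1 d) (scale_tensor s2 e) (t *: u)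
  = s1 ^+ 2 * s2 * t ^+ 3 * cayleyan d e u.
Proof.
rewrite /cayleyan cross_scale mulr_sumr; apply: eq_bigr => i _.
rewrite mulr_sumr; apply: eq_bigr => k _; rewrite !mulr_sumr; apply: eq_bigr => j _.
rewrite !mulr_sumr; apply: eq_bigr => m _.
have -> : col m (scale_tensor s2 e k) *m (t *: u)^T = (s2 * t) *: (col m (e k) *m u^T).
  by rewrite /scale_tensor linearZ /= linearZ /= -scalemxAl -scalemxAr scalerA.
by rewrite mixed_detZZZ !mxE; ring.
Qed.

End Homogeneity.

Section Naturality.
Variables (R S : comNzRingType) (f : {rmorphism R -> S}).
Implicit Types (d e : tensor R) (u : 'cV[R]_3).

Lemma mixed_det_map M N K :
  mixed_det (map_mx f M) (map_mx f N) (map_mx f K) = f (mixed_det M N K).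
Proof. by rewrite /mixed_det -!map_mxD !det_map_mx !rmorphE. Qed.

Lemma map_outer u : map_mx f u *m (map_mx f u)^T = map_mx f (u *m u^T).
Proof. by rewrite map_mxM map_trmx. Qed.

Lemma hessian_map d : hessian (map_tensor f d) =1 map_tensor f (hessian d).
Proof. by move=> i; apply/matrixP => j k; rewrite !mxE mixed_det_map. Qed.

Lemma bordered_map d e u :
  bordered (map_tensor f d) (map_tensor f e) (map_mx f u) = map_mx f (bordered d e u).
Proof. by apply/matrixP => k l; rewrite !mxE map_outer mixed_det_map. Qed.

Lemma dual_form_map d e d' e' u :
  dual_form (map_tensor f d) (map_tensor f e) (map_tensor f d') (map_tensor f e') (map_mx f u)
  = f (dual_form d e d' e' u).
Proof. by rewrite /dual_form !bordered_map map_outer mixed_det_map. Qed.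

Lemma cross_map u : cross (map_mx f u) = map_mx f (cross u).
Proof.
by apply/matrixP; apply: forall_ord3; apply: forall_ord3; rewrite !mxE /= ?rmorphN ?rmorph0.
Qed.

Lemma cayleyan_map d e u :
  cayleyan (map_tensor f d) (map_tensor f e) (map_mx f u) = f (cayleyan d e u).
Proof.
rewrite /cayleyan cross_map rmorph_sum; apply: eq_bigr => i _.
rewrite rmorph_sum; apply: eq_bigr => k _; rewrite rmorphM mxE; congr (_ * _).
rewrite rmorph_sum; apply: eq_bigr => j _; rewrite rmorph_sum; apply: eq_bigr => m _.
rewrite rmorphM mxE -mixed_det_map; congr (_ * mixed_det _ _ _).
by rewrite map_mxM map_trmx map_col.
Qed.

End Naturality.

(** Uniform in the ring, so that one formula can be evaluated at a given pair, at the generic pair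
    over [{mpoly k[10 + 3]}], and over polynomials in a further variable. *)
Definition pair_form :=
  forall R : comNzRingType, tensor R -> 'cV[R]_3 -> R.

(** Degrees [a] in the cubic and [b] in the line, weight [m]. The last field stands in for
    functional extensionality, tensors being functions. *)
Record relative_invariant (J : pair_form) (a b m : nat) : Prop := {
  invariant_map : forall (R S : comNzRingType) (f : {rmorphism R -> S}) d u,
    J S (map_tensor f d) (map_mx f u) = f (J R d u);
  invariant_act : forall (R : comNzRingType) (E : 'M[R]_3) d u,
    J R (act E d) (E *m u) = \det E ^+ m * J R d u;
  invariant_scale : forall (R : comNzRingType) (s t : R) d u,
    J R (scale_tensor s d) (t *: u) = s ^+ a * t ^+ b * J R d u;
  invariant_eq : forall (R : comNzRingType) (d d' : tensor R) u,
    d =1 d' -> J R d u = J R d' u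
}.

Lemma relative_invariantM J J' a b m a' b' m' :
  relative_invariant J a b m -> relative_invariant J' a' b' m' ->
  relative_invariant (fun R d u => J R d u * J' R d u) (a + a') (b + b') (m + m').
Proof.
move=> hJ hJ'; split=> *.
- by rewrite (invariant_map hJ) (invariant_map hJ') rmorphM.
- by rewrite (invariant_act hJ) (invariant_act hJ') exprD mulrACA.
- by rewrite (invariant_scale hJ) (invariant_scale hJ') !exprD; ring.
- by congr (_ * _); [apply: (invariant_eq hJ) | apply: (invariant_eq hJ')].
Qed.

Lemma cayleyan_invariant :
  relative_invariant (fun R d u => cayleyan d d u) 3 3 4.
Proof.
split=> *; first exact: cayleyan_map.
- exact: cayleyan_act.
- by rewrite cayleyan_scale; ring.
- exact: eq_cayleyan.
Qed.

(** The Hessian has degree 3 and weight 2; put into the linear slot of [cayleyan], it turns bidegree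
    (3,3) and weight 4 into (5,3) and 6. *)
Lemma cayleyan_hessian_invariant :
  relative_invariant (fun R d u => cayleyan d (hessian d) u) 5 3 6.
Proof.
split=> [R S f d u|R E d u|R s t d u|R d d' u eqd].
- by rewrite -cayleyan_map; apply: eq_cayleyan => // i; rewrite hessian_map.
- rewrite (_ : cayleyan _ _ _ = cayleyan (scale_tensor 1 (act E d))
     (scale_tensor (\det E ^+ 2) (act E (hessian d))) (1 *: (E *m u))).
    by rewrite cayleyan_scale cayleyan_act; ring.
  by rewrite scale1r; apply: eq_cayleyan => i; rewrite ?hessian_act // /scale_tensor scale1r.
- rewrite -[RHS]/(_ * _) (eq_cayleyan _ (frefl _) (hessian_scale s d)) cayleyan_scale; ring.
- by apply: eq_cayleyan => //; apply: eq_hessian.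
Qed.

Lemma dual_form_invariant :
  relative_invariant (fun R d u => dual_form d d d d u) 4 6 6.
Proof.
split=> *; first exact: dual_form_map.
- exact: dual_form_act.
- by rewrite dual_form_scale; ring.
- exact: eq_dual_form.
Qed.

Lemma dual_form_hessian_invariant :
  relative_invariant
    (fun R d u => dual_form (hessian d) (hessian d) (hessian d) (hessian d) u) 12 6 14.
Proof.
split=> [R S f d u|R E d u|R s t d u|R d d' u eqd].
- by rewrite -dual_form_map; apply: eq_dual_form; apply: hessian_map.
- rewrite -[E *m u]scale1r !(eq_dual_form _ (hessian_act E d) (hessian_act E d)
     (hessian_act E d) (hessian_act E d)) dual_form_scale dual_form_act; ring.
- rewrite (eq_dual_form _ (hessian_scale s d) (hessian_scale s d)
     (hessian_scale s d) (hessian_scale s d)) dual_form_scale; ring.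
- by apply: eq_dual_form; apply: eq_hessian.
Qed.

Lemma dual_form_polar_invariant :
  relative_invariant
    (fun R d u => dual_form (hessian d) (hessian d) (hessian d) d u) 10 6 12.
Proof.
split=> [R S f d u|R E d u|R s t d u|R d d' u eqd].
- by rewrite -dual_form_map; apply: eq_dual_form => //; apply: hessian_map.
- have act1 : act E d =1 scale_tensor 1 (act E d) by move=> i; rewrite /scale_tensor scale1r.
  rewrite -[E *m u]scale1r !(eq_dual_form _ (hessian_act E d) (hessian_act E d)
     (hessian_act E d) act1) dual_form_scale dual_form_act; ring.
- rewrite (eq_dual_form _ (hessian_scale s d) (hessian_scale s d)
     (hessian_scale s d) (frefl _)) dual_form_scale; ring.
- by apply: eq_dual_form => //; apply: eq_hessian.
Qed.

(** * Normal forms relative to a line *)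

Definition symmetric_tensor (R : comNzRingType) (d : tensor R) :=
  forall i j k, d i j k = d j i k /\ d i j k = d i k j.

Section Sort.
Variables (R : comNzRingType) (d : tensor R).
Hypothesis d_sym : symmetric_tensor d.

(** A tuple of equations serves as one rewriting system that sorts the indices. *)
Lemma tensor_sort :
  (d o1 o0 o0 = d o0 o0 o1) * (d o0 o1 o0 = d o0 o0 o1) *
  (d o2 o0 o0 = d o0 o0 o2) * (d o0 o2 o0 = d o0 o0 o2) *
  (d o1 o1 o0 = d o0 o1 o1) * (d o1 o0 o1 = d o0 o1 o1) *
  (d o2 o2 o0 = d o0 o2 o2) * (d o2 o0 o2 = d o0 o2 o2) *
  (d o2 o1 o1 = d o1 o1 o2) * (d o1 o2 o1 = d o1 o1 o2) *
  (d o2 o2 o1 = d o1 o2 o2) * (d o2 o1 o2 = d o1 o2 o2) *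
  (d o0 o2 o1 = d o0 o1 o2) * (d o1 o0 o2 = d o0 o1 o2) *
  (d o1 o2 o0 = d o0 o1 o2) * (d o2 o0 o1 = d o0 o1 o2) *
  (d o2 o1 o0 = d o0 o1 o2).
Proof.
have s1 i j k : d i j k = d j i k by case: (d_sym i j k).
have s2 i j k : d i j k = d i k j by case: (d_sym i j k).
do !split; by [rewrite s1 | rewrite s2 | rewrite s1 s2 | rewrite s2 s1 | rewrite s1 s2 s1].
Qed.

End Sort.

(** The coefficient vector of the line x_2 = 0. *)
Definition axis (R : comNzRingType) : 'cV[R]_3 := \col_i (i == o2)%:R.

Section Values.
Variable R : comNzRingType.
Implicit Types d e : tensor R.

Lemma cross_axis (X : 'I_3 -> 'I_3 -> R) :
  \sum_i \sum_k cross (axis R) i k * X i k = X o0 o1 - X o1 o0.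
Proof. by rewrite !big_ord3 !mxE /=; ring. Qed.

Lemma mixed_det_axis (M N : 'M[R]_3) (w : 'cV[R]_3) :
  mixed_det M N (w *m (axis R)^T)
  = w o0 0 * (M o1 o0 * N o2 o1 + N o1 o0 * M o2 o1 - M o1 o1 * N o2 o0 - N o1 o1 * M o2 o0)
  + w o1 0 * (M o0 o1 * N o2 o0 + N o0 o1 * M o2 o0 - M o0 o0 * N o2 o1 - N o0 o0 * M o2 o1)
  + w o2 0 * (M o0 o0 * N o1 o1 + N o0 o0 * M o1 o1 - M o0 o1 * N o1 o0 - N o0 o1 * M o1 o0).
Proof.
pose W : 'M[R]_3 := \matrix_(r, c) if c == o2 then w r 0 else 0.
have -> : w *m (axis R)^T = W.
  apply/matrixP => r c; rewrite !mxE big_ord1 !mxE.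
  by case: (c == o2); rewrite ?mulr1 ?mulr0.
by rewrite /mixed_det !det_mx33 !mxE /=; ring.
Qed.

(** Only the upper left 2x2 blocks of the slices survive, polarized by the 2x2 determinant: for [k],
    [l] below 2 this depends on the restrictions to x_2 = 0 alone. *)
Lemma bordered_axis d e k l :
  bordered d e (axis R) k l
  = d k o0 o0 * e l o1 o1 + e l o0 o0 * d k o1 o1 - d k o0 o1 * e l o1 o0 - e l o0 o1 * d k o1 o0.
Proof. by rewrite mxE mixed_det_axis !mxE /=; ring. Qed.

(** Covariance under diagonal matrices explains the shape: every term contains the index 2 once and
    the indices 0 and 1 four times each. *)
Lemma cayleyan_axis d e : symmetric_tensor d -> symmetric_tensor e ->
  cayleyan d e (axis R) = 2%:R *
   ((d o0 o0 o0 * d o0 o1 o1 - d o0 o0 o1 ^+ 2) * e o1 o1 o2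
   - (d o0 o0 o0 * d o1 o1 o1 - d o0 o0 o1 * d o0 o1 o1) * e o0 o1 o2
   + (d o0 o0 o1 * d o1 o1 o1 - d o0 o1 o1 ^+ 2) * e o0 o0 o2
   + (e o0 o0 o0 * d o0 o1 o1 + d o0 o0 o0 * e o0 o1 o1
      - 2%:R * d o0 o0 o1 * e o0 o0 o1) * d o1 o1 o2
   - (e o0 o0 o0 * d o1 o1 o1 + d o0 o0 o0 * e o1 o1 o1
      - e o0 o0 o1 * d o0 o1 o1 - d o0 o0 o1 * e o0 o1 o1) * d o0 o1 o2
   + (e o0 o0 o1 * d o1 o1 o1 + d o0 o0 o1 * e o1 o1 o1
      - 2%:R * d o0 o1 o1 * e o0 o1 o1) * d o0 o0 o2).
Proof.
move=> d_sym e_sym; rewrite /cayleyan cross_axis !cross_axis !mixed_det_axis !mxE.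
rewrite !(tensor_sort d_sym) !(tensor_sort e_sym).
ring.
Qed.

Lemma mixed_detE (M N K : 'M[R]_3) :
  mixed_det M N K =
    K o0 o0 * (M o1 o1 * N o2 o2 + N o1 o1 * M o2 o2 - M o1 o2 * N o2 o1 - N o1 o2 * M o2 o1)
  + K o0 o1 * (M o1 o2 * N o2 o0 + N o1 o2 * M o2 o0 - M o1 o0 * N o2 o2 - N o1 o0 * M o2 o2)
  + K o0 o2 * (M o1 o0 * N o2 o1 + N o1 o0 * M o2 o1 - M o1 o1 * N o2 o0 - N o1 o1 * M o2 o0)
  + K o1 o0 * (M o2 o1 * N o0 o2 + N o2 o1 * M o0 o2 - M o2 o2 * N o0 o1 - N o2 o2 * M o0 o1)
  + K o1 o1 * (M o0 o0 * N o2 o2 + N o0 o0 * M o2 o2 - M o0 o2 * N o2 o0 - N o0 o2 * M o2 o0)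
  + K o1 o2 * (M o0 o1 * N o2 o0 + N o0 o1 * M o2 o0 - M o0 o0 * N o2 o1 - N o0 o0 * M o2 o1)
  + K o2 o0 * (M o0 o1 * N o1 o2 + N o0 o1 * M o1 o2 - M o0 o2 * N o1 o1 - N o0 o2 * M o1 o1)
  + K o2 o1 * (M o0 o2 * N o1 o0 + N o0 o2 * M o1 o0 - M o0 o0 * N o1 o2 - N o0 o0 * M o1 o2)
  + K o2 o2 * (M o0 o0 * N o1 o1 + N o0 o0 * M o1 o1 - M o0 o1 * N o1 o0 - N o0 o1 * M o1 o0).
Proof. by rewrite /mixed_det !det_mx33 !mxE; ring. Qed.

Lemma hessian_sym d : symmetric_tensor (hessian d).
Proof.
by move=> i j k; rewrite !mxE; split; [exact: mixed_detC | exact: mixed_detAC].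
Qed.

Lemma dual_form_axis d1 d2 d3 d4 :
  dual_form d1 d2 d3 d4 (axis R) =
  bordered d1 d2 (axis R) o0 o0 * bordered d3 d4 (axis R) o1 o1
  + bordered d3 d4 (axis R) o0 o0 * bordered d1 d2 (axis R) o1 o1
  - bordered d1 d2 (axis R) o0 o1 * bordered d3 d4 (axis R) o1 o0
  - bordered d3 d4 (axis R) o0 o1 * bordered d1 d2 (axis R) o1 o0.
Proof. by rewrite /dual_form mixed_det_axis !mxE /=; ring. Qed.

Section NormalForm.
Variable d : tensor R.
Hypothesis d_sym : symmetric_tensor d.
Hypotheses (d001 : d o0 o0 o1 = 0) (d011 : d o0 o1 o1 = 0)
  (d002 : d o0 o0 o2 = 0) (d012 : d o0 o1 o2 = 0) (d112 : d o1 o1 o2 = 0).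

Let sparse := (tensor_sort d_sym, d001, d011, d002, d012, d112).
Let h := hessian d.

Lemma hessian_normal :
  (h o0 o0 o0 = 0) * (h o1 o1 o1 = 0) *
  (h o0 o0 o1 = 2%:R * d o0 o0 o0 * d o1 o1 o1 * d o0 o2 o2) *
  (h o0 o1 o1 = 2%:R * d o0 o0 o0 * d o1 o1 o1 * d o1 o2 o2) *
  (h o0 o1 o2 = d o0 o0 o0 * d o1 o1 o1 * d o2 o2 o2).
Proof. by do !split; rewrite mxE mixed_detE !sparse; ring. Qed.

Lemma cayleyan_normal :
  cayleyan d h (axis R) = - 2%:R * (d o0 o0 o0 * d o1 o1 o1) ^+ 2 * d o2 o2 o2.
Proof.
by rewrite cayleyan_axis ?hessian_normal ?sparse //; [ring | exact: hessian_sym].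
Qed.

Lemma dual_form_normal :
  dual_form d d d d (axis R) = - 2%:R * (d o0 o0 o0 * d o1 o1 o1) ^+ 2.
Proof. by rewrite dual_form_axis !bordered_axis !sparse; ring. Qed.

End NormalForm.

Section HessianNormalForm.
Variables (d h : tensor R) (c a b : R).
Hypotheses (d_sym : symmetric_tensor d) (h_sym : symmetric_tensor h).
Hypotheses (d001 : d o0 o0 o1 = 0) (d011 : d o0 o1 o1 = 0).
Hypotheses (h000 : h o0 o0 o0 = 0) (h111 : h o1 o1 o1 = 0)
  (h001 : h o0 o0 o1 = 2%:R * c * a) (h011 : h o0 o1 o1 = 2%:R * c * b).

Let sparse := (h000, h111, h001, h011).

(** For [h] the Hessian, [c] is d000 d111 and [a], [b] are d022, d122. On the line [h] is the binary
    cubic 6 c x_0 x_1 (a x_0 + b x_1), which has a repeated root exactly when c a b = 0. *)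
Lemma dual_form_hessian_normal :
  dual_form h h h h (axis R) = 96%:R * c ^+ 4 * (a * b) ^+ 2.
Proof. by rewrite dual_form_axis !bordered_axis !(tensor_sort h_sym) !sparse; ring. Qed.

(** The derivative of the discriminant at [h] in the direction [d]. When a b = 0, the binary cubic
    of [h] has a double root and this derivative is proportional to the value of [d] there. *)
Lemma dual_form_polar_normal :
  dual_form h h h d (axis R) =
  - 16%:R * c ^+ 3 * (d o0 o0 o0 * b ^+ 3 + d o1 o1 o1 * a ^+ 3).
Proof.
rewrite dual_form_axis !bordered_axis !(tensor_sort h_sym) !sparse.
by rewrite !(tensor_sort d_sym) d001 d011; ring.
Qed.

End HessianNormalForm.
End Values.

(** * Changes of basis that fix a line *)

Definition mx3 (R : comNzRingType) (s : seq (seq R)) : 'M[R]_3 :=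
  \matrix_(i, j) nth 0 (nth [::] s i) j.

Section Action.
Variable R : comNzRingType.
Implicit Types (d : tensor R) (E : 'M[R]_3).

Lemma act_mul E E' d : act E (act E' d) =1 act (E *m E') d.
Proof.
move=> i; rewrite /act trmx_mul !mulmxA; congr (_ *m _).
rewrite -!mulmxA; congr (_ *m _).
transitivity (E' *m (\sum_a E i a *: \sum_b E' a b *: d b) *m E'^T).
  rewrite mulmx_sumr mulmx_suml; apply: eq_bigr => a _.
  by rewrite -scalemxAr -scalemxAl.
rewrite -mulmxA; congr (_ *m (_ *m _)).
under eq_bigr => a _ do rewrite scaler_sumr.
rewrite exchange_big; apply: eq_bigr => b _ /=.
rewrite mxE scaler_suml; apply: eq_bigr => a _.
by rewrite scalerA.
Qed.

Lemma act1 d : act 1%:M d =1 d.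
Proof.
move=> i; rewrite /act mul1mx trmx1 mulmx1 [RHS](sum1_delta d).
by apply: eq_bigr => a _; rewrite mxE.
Qed.

Lemma act_sym E d : symmetric_tensor d -> symmetric_tensor (act E d).
Proof.
move=> d_sym i j k; rewrite !act_entry; split.
  rewrite exchange_big; apply: eq_bigr => b _; apply: eq_bigr => a _.
  apply: eq_bigr => c _; case: (d_sym a b c) => -> _; ring.
apply: eq_bigr => a _; rewrite exchange_big; apply: eq_bigr => c _.
apply: eq_bigr => b _; case: (d_sym a b c) => _ ->; ring.
Qed.

(** The general matrix fixing [axis]: [x], [y], [z], [w] change the basis of the line, [s] and [t]
    shear the third basis vector along it. *)
Definition frame (x y z w s t : R) := mx3 [:: [:: x; y; 0]; [:: z; w; 0]; [:: s; t; 1]].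

Lemma det_frame x y z w s t : \det (frame x y z w s t) = x * w - y * z.
Proof. by rewrite det_mx33 !mxE /=; ring. Qed.

Lemma frame_axis x y z w s t : frame x y z w s t *m axis R = axis R.
Proof.
by apply/matrixP; apply: forall_ord3; move=> j; rewrite !mxE big_ord3 !mxE /=; ring.
Qed.

Lemma act_frame x y z w s t d : symmetric_tensor d ->
  let d' := act (frame x y z w s t) d in
  (d' o0 o0 o0 = x ^+ 3 * d o0 o0 o0 + 3%:R * x ^+ 2 * y * d o0 o0 o1
                 + 3%:R * x * y ^+ 2 * d o0 o1 o1 + y ^+ 3 * d o1 o1 o1) *
  (d' o0 o0 o1 = x ^+ 2 * z * d o0 o0 o0 + (2%:R * x * y * z + x ^+ 2 * w) * d o0 o0 o1
                 + (2%:R * x * y * w + y ^+ 2 * z) * d o0 o1 o1 + y ^+ 2 * w * d o1 o1 o1) *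
  (d' o0 o1 o1 = x * z ^+ 2 * d o0 o0 o0 + (2%:R * x * z * w + y * z ^+ 2) * d o0 o0 o1
                 + (2%:R * y * z * w + x * w ^+ 2) * d o0 o1 o1 + y * w ^+ 2 * d o1 o1 o1) *
  (d' o1 o1 o1 = z ^+ 3 * d o0 o0 o0 + 3%:R * z ^+ 2 * w * d o0 o0 o1
                 + 3%:R * z * w ^+ 2 * d o0 o1 o1 + w ^+ 3 * d o1 o1 o1).
Proof.
move=> d_sym d'; do !split; rewrite /d' act_entry !big_ord3 !mxE /= !(tensor_sort d_sym); ring.
Qed.

Lemma act_shear s t d : symmetric_tensor d ->
  let d' := act (frame 1 0 0 1 s t) d in
  (d' o0 o0 o2 = s * d o0 o0 o0 + t * d o0 o0 o1 + d o0 o0 o2) *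
  (d' o1 o1 o2 = s * d o0 o1 o1 + t * d o1 o1 o1 + d o1 o1 o2).
Proof.
move=> d_sym d'; split; rewrite /d' act_entry !big_ord3 !mxE /= !(tensor_sort d_sym); ring.
Qed.

End Action.

(** * Degenerate pairs and the vanishing of the four sections *)

Section Degenerate.
Variable k : fieldType.
Implicit Types (d : tensor k) (u : 'cV[k]_3).

(** The rows of [b] are points and [(b *m u) i 0] is the value of the line at row [i]. Rows 0 and 1
    span the line, on which only the cube of the coordinate 1 can survive; the case of a line inside
    the curve is included. *)
Definition flex_tangent d u := exists2 b : 'M[k]_3, b \in unitmx &
  [/\ (b *m u) o0 0 = 0, (b *m u) o1 0 = 0, act b d o0 o0 o0 = 0,
      act b d o0 o0 o1 = 0 & act b d o0 o1 o1 = 0].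

Definition singular_on_line d u := exists2 b : 'M[k]_3, b \in unitmx &
  (b *m u) o0 0 = 0 /\ forall i, act b d o0 o0 i = 0.

Definition triple_point d := exists2 b : 'M[k]_3, b \in unitmx &
  forall i j, act b d o2 i j = 0.

Definition degenerate d u :=
  [\/ flex_tangent d u, singular_on_line d u | triple_point d].

Lemma degenerate_act (E : 'M[k]_3) d u :
  E \in unitmx -> degenerate (act E d) (E *m u) -> degenerate d u.
Proof.
move=> unitE [[b unitb]|[b unitb]|[b unitb]]; rewrite ?mulmxA.
- rewrite !act_mul => flat; apply: Or31; exists (b *m E) => //.
  by rewrite unitmx_mul unitb.
- move=> [bu bd]; apply: Or32; exists (b *m E); first by rewrite unitmx_mul unitb.
  by split=> // i; rewrite -act_mul.
move=> bd; apply: Or33; exists (b *m E); first by rewrite unitmx_mul unitb.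
by move=> i j; rewrite -act_mul.
Qed.

(* The four products have equal degrees in d and in u: (3,3), (9,9), (24,24)
   and (18,18). *)
Definition vanishing d u :=
  [/\ cayleyan d d u = 0,
      cayleyan d (hessian d) u * dual_form d d d d u = 0,
      dual_form (hessian d) (hessian d) (hessian d) (hessian d) u * dual_form d d d d u ^+ 3 = 0
    & dual_form (hessian d) (hessian d) (hessian d) d u * dual_form d d d d u ^+ 2 = 0].

Lemma vanishing_act (E : 'M[k]_3) d u : vanishing d u -> vanishing (act E d) (E *m u).
Proof.
move=> [v1 v2 v3 v4]; split.
- by rewrite (invariant_act cayleyan_invariant) v1 mulr0.
- rewrite (invariant_act cayleyan_hessian_invariant) (invariant_act dual_form_invariant).
  by rewrite mulrACA v2 mulr0.
- rewrite (invariant_act dual_form_hessian_invariant) (invariant_act dual_form_invariant).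
  by rewrite exprMn mulrACA v3 mulr0.
- rewrite (invariant_act dual_form_polar_invariant) (invariant_act dual_form_invariant).
  by rewrite exprMn mulrACA v4 mulr0.
Qed.

Lemma move_to_axis u : u != 0 -> exists2 b : 'M[k]_3, b \in unitmx & b *m u = axis k.
Proof.
move=> u_neq0; have [i ui] : exists i, u i 0 != 0.
  apply/existsP; apply: contraNT u_neq0; rewrite negb_exists => /forallP u0.
  by apply/eqP/matrixP => i j; rewrite (ord1 j) mxE; apply/eqP; have := u0 i; rewrite negbK.
move: i ui; apply: forall_ord3 => ui.
- exists (mx3 [:: [:: - (u o1 0 / u o0 0); 1; 0]; [:: - (u o2 0 / u o0 0); 0; 1];
                  [:: (u o0 0)^-1; 0; 0]]).
    by rewrite unitmxE det_mx33 !mxE /= unitfE mulr0 !mul0r !mulr0 !subr0 !addr0 !mul1r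
       ?(mulr0, mul0r, sub0r, oppr0, add0r, opprK) ?oppr_eq0 invr_eq0.
  by apply/matrixP; apply: forall_ord3 => j; rewrite (ord1 j) !mxE big_ord3 !mxE /=; field.
- exists (mx3 [:: [:: 1; - (u o0 0 / u o1 0); 0]; [:: 0; - (u o2 0 / u o1 0); 1];
                  [:: 0; (u o1 0)^-1; 0]]).
    by rewrite unitmxE det_mx33 !mxE /= unitfE
       ?(mulr0, mul0r, sub0r, oppr0, add0r, opprK, subr0, addr0, mul1r) ?oppr_eq0 invr_eq0.
  by apply/matrixP; apply: forall_ord3 => j; rewrite (ord1 j) !mxE big_ord3 !mxE /=; field.
- exists (mx3 [:: [:: 1; 0; - (u o0 0 / u o2 0)]; [:: 0; 1; - (u o1 0 / u o2 0)];
                  [:: 0; 0; (u o2 0)^-1]]).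
    by rewrite unitmxE det_mx33 !mxE /= unitfE
       ?(mulr0, mul0r, sub0r, oppr0, add0r, opprK, subr0, addr0, mul1r) ?oppr_eq0 invr_eq0.
  by apply/matrixP; apply: forall_ord3 => j; rewrite (ord1 j) !mxE big_ord3 !mxE /=; field.
Qed.

End Degenerate.

Section Classification.
Variable k : closedFieldType.
Hypotheses (char_not2 : 2%N \notin [pchar k]) (char_not3 : 3%N \notin [pchar k]).
Implicit Types (d : tensor k) (u : 'cV[k]_3).

Lemma two_neq0 : 2%:R != 0 :> k.
Proof. by move: char_not2; rewrite inE. Qed.

Lemma three_neq0 : 3%:R != 0 :> k.
Proof. by move: char_not3; rewrite inE. Qed.

Lemma six_neq0 : 6%:R != 0 :> k.
Proof. by rewrite (_ : 6%:R = 2%:R * 3%:R) ?mulf_neq0 ?two_neq0 ?three_neq0 // -natrM. Qed.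

(** Each condition removes coefficients: the Cayleyan kills d012, its polar by the Hessian kills
    d222, and the last two sections together kill d022 and d122. Only x_0 and x_1 then occur in the
    cubic, so the third basis vector is a triple point. *)
Lemma degenerate_normal d : symmetric_tensor d ->
  d o0 o0 o1 = 0 -> d o0 o1 o1 = 0 -> d o0 o0 o2 = 0 -> d o1 o1 o2 = 0 ->
  d o0 o0 o0 != 0 -> d o1 o1 o1 != 0 ->
  vanishing d (axis k) -> degenerate d (axis k).
Proof.
move=> d_sym d001 d011 d002 d112 d000 d111 [v1 v2 v3 v4].
have nz2 := two_neq0; have nz3 := three_neq0.
have d012 : d o0 o1 o2 = 0.
  move: v1; rewrite cayleyan_axis // d001 d011 d002 d112 => v1.
  have /eqP : 6%:R * (d o0 o0 o0 * d o1 o1 o1) * d o0 o1 o2 = 0.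
    by rewrite -[RHS]oppr0 -[in RHS]v1; ring.
  by rewrite !mulf_eq0 (negbTE six_neq0) (negbTE d000) (negbTE d111) => /eqP.
have hN := hessian_normal d_sym d001 d011 d002 d012 d112.
have c_neq0 : d o0 o0 o0 * d o1 o1 o1 != 0 by rewrite mulf_neq0.
have disc_neq0 : dual_form d d d d (axis k) != 0.
  by rewrite dual_form_normal // mulf_neq0 ?oppr_eq0 ?expf_neq0.
have d222 : d o2 o2 o2 = 0.
  move/eqP: v2; rewrite mulf_eq0 (negbTE disc_neq0) orbF cayleyan_normal //.
  by rewrite !mulf_eq0 oppr_eq0 (negbTE nz2) (negbTE d000) (negbTE d111) => /eqP.
have h001 : hessian d o0 o0 o1 = 2%:R * (d o0 o0 o0 * d o1 o1 o1) * d o0 o2 o2.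
  by rewrite hN; ring.
have h011 : hessian d o0 o1 o1 = 2%:R * (d o0 o0 o0 * d o1 o1 o1) * d o1 o2 o2.
  by rewrite hN; ring.
have ab : d o0 o2 o2 * d o1 o2 o2 = 0.
  move/eqP: v3; rewrite mulf_eq0 expf_eq0 (negbTE disc_neq0) orbF.
  rewrite (dual_form_hessian_normal (hessian_sym d) _ _ h001 h011) ?hN //.
have nz96 : 96%:R != 0 :> k.
    by rewrite (_ : 96%:R = 2%:R ^+ 5 * 3%:R) ?mulf_neq0 ?expf_neq0 // -natrX -natrM.
  by rewrite mulf_eq0 (negbTE (mulf_neq0 nz96 (expf_neq0 4 c_neq0))) expf_eq0 => /eqP.
have cubes : d o0 o0 o0 * d o1 o2 o2 ^+ 3 + d o1 o1 o1 * d o0 o2 o2 ^+ 3 = 0.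
  move/eqP: v4; rewrite mulf_eq0 expf_eq0 (negbTE disc_neq0) orbF.
  rewrite (dual_form_polar_normal d_sym (hessian_sym d) d001 d011 _ _ h001 h011) ?hN //.
  have nz16 : - 16%:R != 0 :> k.
    by rewrite (_ : 16%:R = 2%:R ^+ 4) ?oppr_eq0 ?expf_neq0 // -natrX.
  by rewrite mulf_eq0 (negbTE (mulf_neq0 nz16 (expf_neq0 3 c_neq0))) => /eqP.
have [d022 d122] : d o0 o2 o2 = 0 /\ d o1 o2 o2 = 0.
  move/eqP: ab; rewrite mulf_eq0 => /orP[] /eqP z; move/eqP: cubes;
  rewrite z expr0n mulr0 ?addr0 ?add0r mulf_eq0 expf_eq0 ?(negbTE d000) ?(negbTE d111) /=;
  by move/eqP.
apply: Or33; exists 1%:M; first exact: unitmx1.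
by apply: forall_ord3; apply: forall_ord3; rewrite act1 ?(tensor_sort d_sym).
Qed.

Lemma unit_frame (x y z w s t : k) : x * w - y * z != 0 -> frame x y z w s t \in unitmx.
Proof. by rewrite unitmxE det_frame unitfE. Qed.

(** The first basis vector is a repeated root of the restriction: d011 = 0 makes the restriction a
    multiple of a cube, d002 = 0 makes the curve singular there. *)
Lemma degenerate_double_root d :
  d o0 o0 o0 = 0 -> d o0 o0 o1 = 0 -> d o0 o1 o1 = 0 \/ d o0 o0 o2 = 0 ->
  degenerate d (axis k).
Proof.
move=> d000 d001 [d011|d002].
  by apply: Or31; exists 1%:M; rewrite ?unitmx1 // mul1mx !act1; split; rewrite ?mxE.
apply: Or32; exists 1%:M; rewrite ?unitmx1 // mul1mx !mxE; split=> //.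
by apply: forall_ord3; rewrite act1.
Qed.

Lemma degenerate_cube d : symmetric_tensor d ->
  d o0 o0 o1 = 0 -> d o0 o1 o1 = 0 -> d o1 o1 o1 = 0 -> degenerate d (axis k).
Proof.
move=> d_sym d001 d011 d111; apply: Or31; exists (frame 0 1 1 0 0 0).
  by rewrite unit_frame // mul0r mul1r sub0r oppr_eq0 oner_neq0.
rewrite frame_axis !(act_frame 0 1 1 0 0 0 d_sym) d001 d011 d111.
by split; rewrite ?mxE //; ring.
Qed.

Lemma quadratic_root (a b c : k) : a != 0 -> exists x, a * x ^+ 2 + b * x + c = 0.
Proof.
move=> a_neq0; have [x] := @solve_monicpoly k 2 (fun i => nth 0 [:: - c / a; - b / a] i) isT.
rewrite !big_ord_recl big_ord0 /= => eq_x; exists x; rewrite eq_x; by field.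
Qed.

(* Any cubic moves, by a change of basis preserving the line x_2 = 0, to one
   whose restriction to that line is x_1^2 times a linear form, or a sum of
   cubes a x_0^3 + b x_1^3 with a != 0: put the first basis vector at a root of
   the Hessian of the restriction. *)
Lemma line_normal_form (Q : tensor k -> Prop) :
  (forall d (E : 'M[k]_3), symmetric_tensor d -> E \in unitmx -> E *m axis k = axis k ->
     Q (act E d) -> Q d) ->
  (forall d, symmetric_tensor d -> d o0 o0 o0 = 0 -> d o0 o0 o1 = 0 -> Q d) ->
  (forall d, symmetric_tensor d -> d o0 o0 o0 != 0 -> d o0 o0 o1 = 0 -> d o0 o1 o1 = 0 -> Q d) ->
  forall d, symmetric_tensor d -> Q d.
Proof.
move=> Q_act Q_double Q_cubes.
have Q_frame x y z w d : symmetric_tensor d -> x * w - y * z != 0 ->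
    Q (act (frame x y z w 0 0) d) -> Q d.
  by move=> d_sym det_neq0; apply: Q_act; rewrite ?unit_frame ?frame_axis.
have Q_root d : symmetric_tensor d -> d o0 o0 o0 * d o0 o1 o1 = d o0 o0 o1 ^+ 2 -> Q d.
  move=> d_sym root_p; have [d000|d000] := eqVneq (d o0 o0 o0) 0.
    by apply: Q_double => //; apply/eqP; move/eqP: root_p; rewrite d000 mul0r eq_sym expf_eq0.
  (* Completing the cube: this shear kills d001, and the vanishing of the Hessian at the first
     vector then kills d011. *)
  apply: (@Q_frame 1 0 (- (d o0 o0 o1 / d o0 o0 o0)) 1) => //.
    by rewrite mul1r mul0r subr0 oner_neq0.
  apply: Q_cubes; rewrite ?(act_frame _ _ _ _ _ _ d_sym); first exact: act_sym.
  - by rewrite !(expr0n, expr1n, mul1r, mul0r, mulr0, addr0).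
  - by field.
  - rewrite (_ : d o0 o1 o1 = d o0 o0 o1 ^+ 2 / d o0 o0 o0); first by field.
    by rewrite -root_p; field.
move=> d d_sym.
(* At the vector (x, 1) the Hessian of the restriction is quadratic in x, and its leading
   coefficient is the value at (1, 0): either (1, 0) is a root or the quadratic can be solved. *)
have [|not_root] := eqVneq (d o0 o0 o0 * d o0 o1 o1) (d o0 o0 o1 ^+ 2); first exact: Q_root.
rewrite -subr_eq0 in not_root.
have [x root_x] := quadratic_root (d o0 o0 o0 * d o1 o1 o1 - d o0 o0 o1 * d o0 o1 o1)
  (d o0 o0 o1 * d o1 o1 o1 - d o0 o1 o1 ^+ 2) not_root.
apply: (@Q_frame x 1 1 0) => //; first by rewrite mulr0 mul1r sub0r oppr_eq0 oner_neq0.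
apply: Q_root; first exact: act_sym.
apply/eqP; rewrite -subr_eq0 -[X in _ == X]root_x !(act_frame _ _ _ _ _ _ d_sym).
by apply/eqP; ring.
Qed.

Theorem vanishing_degenerate d u :
  symmetric_tensor d -> u != 0 -> vanishing d u -> degenerate d u.
Proof.
move=> d_sym u_neq0; have [b unitb bu] := move_to_axis u_neq0.
move/(vanishing_act b) => van; apply: (degenerate_act unitb); move: van; rewrite bu.
move: (act b d) (act_sym b d_sym) => {d d_sym u u_neq0 b unitb bu}.
apply: line_normal_form => [d E d_sym unitE E_axis IH van|d d_sym d000 d001 van|
    d d_sym d000 d001 d011 van].
- by apply: (degenerate_act unitE); rewrite E_axis; apply: IH; rewrite -E_axis; apply: vanishing_act.
- have [v1 _ _ _] := van; move: v1; rewrite cayleyan_axis // d000 d001 => v1.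
  (* With a double root at the first basis vector the Cayleyan reduces to -6 d011^2 d002. *)
  have /eqP : 6%:R * d o0 o1 o1 ^+ 2 * d o0 o0 o2 = 0.
    by rewrite -[RHS]oppr0 -[in RHS]v1; ring.
  rewrite mulf_eq0 mulf_eq0 (negbTE six_neq0) expf_eq0 /= => zero.
  by apply: degenerate_double_root => //; case/orP: zero => /eqP ->; [left | right].
have [d111|d111] := eqVneq (d o1 o1 o1) 0; first exact: degenerate_cube.
(* This shear clears d002 and d112 and leaves the restriction to the line unchanged. *)
pose E := frame 1 0 0 1 (- (d o0 o0 o2 / d o0 o0 o0)) (- (d o1 o1 o2 / d o1 o1 o1)).
have unitE : E \in unitmx by rewrite unit_frame // mul1r mul0r subr0 oner_neq0.
apply: (degenerate_act unitE); move/(vanishing_act E): van; rewrite frame_axis.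
apply: degenerate_normal; rewrite /E ?(act_frame _ _ _ _ _ _ d_sym) ?(act_shear _ _ d_sym) ?d001 ?d011;
  first exact: act_sym.
all: rewrite ?(expr0n, expr1n, mul1r, mul0r, mulr0, addr0, add0r, mulr1) //=; by field.
Qed.

End Classification.

(** * Invariant sections *)

Lemma cubic_monomialsP (m : 'X_{1..3}) : mdeg m = 3%N -> m \in tval cubic_monomials.
Proof.
have -> : m = [multinom [tuple m o0; m o1; m o2]].
  by apply/mnmP; apply: forall_ord3; rewrite multinomE (tnth_nth 0%N).
rewrite mdegE big_ord3 !multinomE !(tnth_nth 0%N) /=.
case: (m o0) => [|[|[|[|n0]]]]; case: (m o1) => [|[|[|[|n1]]]];
  case: (m o2) => [|[|[|[|n2]]]] //= eq3; rewrite ?inE ?eqxx ?orbT //;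
  by move: eq3; rewrite ?addSn ?addnS.
Qed.

Section FormTensor.
Variable R : comNzRingType.
Implicit Types (F S : {mpoly R[3]}).

(* The third partial derivatives of the cubic form with coefficients c, listed
   in the order of cubic_monomials. *)
Definition form_tensor (c : nat -> R) : tensor R := fun i =>
  \matrix_(j, k)
    let n := nth 0%N (nth [::] (nth [::]
      [:: [:: [:: 0; 3; 4]; [:: 3; 5; 9]; [:: 4; 9; 7]];
          [:: [:: 3; 5; 9]; [:: 5; 1; 6]; [:: 9; 6; 8]];
          [:: [:: 4; 9; 7]; [:: 9; 6; 8]; [:: 7; 8; 2]]] i) j) k in
    c n *+ nth 0%N [:: 6; 6; 6; 2; 2; 2; 2; 2; 2; 1] n.

Definition cubic_coefs F (n : nat) : R := F@_(nth 0%MM cubic_monomials n).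

Definition linear_coefs S : 'cV[R]_3 := \col_i S@_(U_(i))%MM.

Lemma form_tensor_sym c : symmetric_tensor (form_tensor c).
Proof.
by move=> i j k; move: i j k; do 3!apply: forall_ord3; rewrite !mxE.
Qed.

Lemma mpoly_sum_seq n (p : {mpoly R[n]}) (s : seq 'X_{1..n}) :
  uniq s -> {subset msupp p <= s} -> p = \sum_(m <- s) p@_m *: 'X_[m].
Proof.
move=> uniq_s sub_s; apply/mpolyP => m; rewrite raddf_sum /=.
under eq_bigr => m' _ do rewrite mcoeffZ mcoeffX.
have [m_s|m_s] := boolP (m \in s).
  rewrite (bigD1_seq m) //= eqxx mulr1 big1 ?addr0 // => m' /negbTE ->.
  by rewrite mulr0.
rewrite big1_seq => [|m' /andP[_ m'_s]].
  by apply/memN_msupp_eq0; apply: contra m_s => /sub_s.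
have [eq_m'|] := eqVneq m' m; last by rewrite mulr0.
by rewrite -eq_m' m'_s in m_s.
Qed.

(** Euler's formula applied three times; the factor 6 stays on the left because the ring is
    arbitrary. *)
Lemma cubicE F : F \is 3.-homog ->
  F *+ 6 = \sum_i \sum_j \sum_k
    form_tensor (cubic_coefs F) i j k *: ('X_i * 'X_j * 'X_k).
Proof.
move=> /dhomogP F3.
rewrite {1}(@mpoly_sum_seq _ F cubic_monomials); last 2 first.
- by [].
- by move=> m /F3; apply: cubic_monomialsP.
rewrite (big_nth 0%MM) -/cubic_coefs.
under eq_bigr => n _ do rewrite -[F@_ _]/(cubic_coefs F n).
move: (cubic_coefs F) => c {F F3}.
have monE a b e : 'X_[R, [multinom [tuple a; b; e]]] = 'X_o0 ^+ a * 'X_o1 ^+ b * 'X_o2 ^+ e.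
  rewrite mpolyXE_id !big_ord_recr big_ord0 /= mul1r.
  rewrite !multinomE !(tnth_nth 0%N) /=.
  by congr ('X_ _ ^+ _ * 'X_ _ ^+ _ * 'X_ _ ^+ _); apply: val_inj.
rewrite !big_ord3; move: ('X_o0) ('X_o1) ('X_o2) monE => X0 X1 X2 monE.
rewrite [size _]/= big_mkord !big_ord_recr big_ord0 /=.
rewrite !monE.
rewrite !mxE /=.
rewrite -!mul_mpolyC !mpolyCMn.
ring.
Qed.
End FormTensor.

(** * Cubic forms as symmetric trilinear forms *)

Section Trilinear.
Variable R : comNzRingType.
Implicit Types (d : tensor R) (x y z : 'I_3 -> R).

Definition tri d x y z : R := \sum_i \sum_j \sum_k x i * y j * z k * d i j k.

Lemma eq_tri d d' x x' y y' z z' : d =1 d' -> x =1 x' -> y =1 y' -> z =1 z' ->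
  tri d x y z = tri d' x' y' z'.
Proof.
move=> eqd eqx eqy eqz; apply: eq_bigr => i _; apply: eq_bigr => j _.
by apply: eq_bigr => l _; rewrite eqd eqx eqy eqz.
Qed.

Lemma act_tri (E : 'M[R]_3) d i j l : act E d i j l = tri d (E i) (E j) (E l).
Proof. by rewrite act_entry. Qed.

Lemma tri_sum1 (A : 'M[R]_3) d x y z :
  tri d (fun a => \sum_i x i * A i a) y z = \sum_i x i * tri d (A i) y z.
Proof. by rewrite /tri !big_ord3; ring. Qed.

Lemma tri_sum2 (A : 'M[R]_3) d x y z :
  tri d x (fun a => \sum_i y i * A i a) z = \sum_i y i * tri d x (A i) z.
Proof. by rewrite /tri !big_ord3; ring. Qed.

Lemma tri_sum3 (A : 'M[R]_3) d x y z :
  tri d x y (fun a => \sum_i z i * A i a) = \sum_i z i * tri d x y (A i).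
Proof. by rewrite /tri !big_ord3; ring. Qed.

Lemma tri_act (E : 'M[R]_3) d x y z :
  tri (act E d) x y z = tri d (fun a => \sum_i x i * E i a)
    (fun b => \sum_j y j * E j b) (fun c => \sum_l z l * E l c).
Proof.
rewrite tri_sum1; apply: eq_bigr => i _; rewrite tri_sum2 mulr_sumr.
apply: eq_bigr => j _; rewrite tri_sum3 !mulr_sumr; apply: eq_bigr => l _.
by rewrite act_tri !mulrA.
Qed.

Lemma polarization d x y z : symmetric_tensor d ->
  let q x := tri d x x x in
  6%:R * tri d x y z
  = q (fun i => x i + y i + z i) - q (fun i => x i + y i) - q (fun i => x i + z i)
    - q (fun i => y i + z i) + q x + q y + q z.
Proof. by move=> d_sym q; rewrite /q /tri !big_ord3 !(tensor_sort d_sym); ring. Qed.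

Lemma tri_delta d i j l :
  tri d (fun a => (i == a)%:R) (fun a => (j == a)%:R) (fun a => (l == a)%:R) = d i j l.
Proof.
have sum_delta (f : 'I_3 -> R) r : \sum_a (r == a)%:R * f a = f r.
  rewrite (bigD1 r) //= eqxx mul1r big1 ?addr0 // => a /negbTE ne.
  by rewrite eq_sym ne mul0r.
rewrite /tri -[RHS](sum_delta (fun a => d a j l)); apply: eq_bigr => a _.
rewrite -(sum_delta (fun b => d a b l)) mulr_sumr; apply: eq_bigr => b _.
by rewrite -(sum_delta (d a b)) !mulr_sumr; apply: eq_bigr => c _; rewrite !mulrA.
Qed.

Lemma form_tensor_ext (c c' : nat -> R) :
  (forall n, (n < 10)%N -> c n = c' n) -> form_tensor c =1 form_tensor c'.
Proof.
move=> eq_c i; apply/matrixP => j l; rewrite !mxE /= eq_c //.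
by move: i j l; do 3!apply: forall_ord3.
Qed.

End Trilinear.

Section FormEvaluation.
Variables (R S : comNzRingType) (f : {rmorphism R -> S}) (h : 'I_3 -> S).

Lemma cubic_mmap F : F \is 3.-homog ->
  mmap f h F *+ 6 = tri (map_tensor f (form_tensor (cubic_coefs F))) h h h.
Proof.
move=> F3; rewrite -mmapMn (cubicE F3) /tri raddf_sum; apply: eq_bigr => i _.
rewrite raddf_sum; apply: eq_bigr => j _; rewrite raddf_sum; apply: eq_bigr => l _.
by rewrite /= mmapZ !rmorphM /= !mmapX !mmap1U [in RHS]mxE mulrC.
Qed.

Lemma linear_formE (T : {mpoly R[3]}) : T \is 1.-homog -> T = \sum_i linear_coefs T i 0 *: 'X_i.
Proof.
move=> /dhomogP T1; rewrite {1}(@mpoly_sum_seq _ _ T [seq U_(i)%MM | i <- enum 'I_3]).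
- by rewrite big_map big_enum; apply: eq_bigr => i _; rewrite mxE.
- by rewrite map_inj_uniq ?enum_uniq // => i j /eqP; rewrite eq_mnm1 => /eqP.
by move=> m /T1 /eqP /mdeg1P[i /eqP ->]; rewrite map_f ?mem_enum.
Qed.

Lemma linear_mmap T : T \is 1.-homog -> mmap f h T = \sum_i f (linear_coefs T i 0) * h i.
Proof.
move=> T1; rewrite {1}(linear_formE T1) raddf_sum; apply: eq_bigr => i _.
by rewrite /= mmapZ mmapX mmap1U.
Qed.

End FormEvaluation.

Lemma comp_dhomog (R : comNzRingType) n m (p : {mpoly R[n]}) (t : n.-tuple {mpoly R[m]}) d :
  p \is d.-homog -> (forall i, tnth t i \is 1.-homog) -> p \mPo t \is d.-homog.
Proof.
move=> /dhomogP p_d t1; rewrite comp_mpolyE big_seq; apply: rpred_sum => a /p_d a_d.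
apply: dhomogZ; have <- : (\sum_i a i = d)%N by rewrite -mdegE; exact: a_d.
apply: (big_ind2 (fun (q : {mpoly R[m]}) e => q \is e.-homog)) => [|q e q' e'|i _].
- exact: dhomog1.
- exact: dhomogM.
by rewrite -[X in _ \is X.-homog]mul1n dhomogMn.
Qed.

Section FormAction.
Variable k : fieldType.
Hypothesis six_neq0 : 6%:R != 0 :> k.
Implicit Types (F S : {mpoly k[3]}) (g : 'M[k]_3).

(** Polarization recovers the tensor from its cubic values once 6 is invertible, so substitutions in
    forms can be compared pointwise. *)
Lemma tensor_eq_cubes (d d' : tensor k) : symmetric_tensor d -> symmetric_tensor d' ->
  (forall x, tri d x x x = tri d' x x x) -> forall i j l, d i j l = d' i j l.
Proof.
move=> d_sym d'_sym eq_q i j l; rewrite -tri_delta -[RHS]tri_delta.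
by apply: (mulfI six_neq0); rewrite !polarization // !eq_q.
Qed.

Lemma cubic_eval F x : F \is 3.-homog ->
  F.@[x] *+ 6 = tri (form_tensor (cubic_coefs F)) x x x.
Proof.
move=> F3; rewrite /meval (cubic_mmap idfun) //.
by apply: eq_tri => // i; apply/matrixP => j l; rewrite mxE.
Qed.

Lemma act_form_homog g F d : F \is d.-homog -> act_form g F \is d.-homog.
Proof.
move=> F_d; apply: comp_dhomog => // i; rewrite tnth_mktuple.
by apply: rpred_sum => j _; rewrite dhomogZ // dhomogX; apply/eqP/mdeg1.
Qed.

Lemma act_form_eval g F x :
  (act_form g F).@[x] = F.@[fun i => \sum_j invmx g i j * x j].
Proof.
rewrite comp_mpoly_meval; apply: meval_eq => i; rewrite tnth_mktuple raddf_sum.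
by apply: eq_bigr => j _; rewrite /= mevalZ mevalXU.
Qed.

(** The substitution sends e_i to column [i] of [invmx g], while [act] reads the new basis off the
    rows; hence the transpose. *)
Lemma act_form_tensor g F : F \is 3.-homog ->
  form_tensor (cubic_coefs (act_form g F)) =1 act (invmx g)^T (form_tensor (cubic_coefs F)).
Proof.
move=> F3 i; apply/matrixP => j l; apply: tensor_eq_cubes.
- exact: form_tensor_sym.
- exact/act_sym/form_tensor_sym.
move=> x; rewrite tri_act -cubic_eval ?act_form_homog // act_form_eval cubic_eval //.
by apply: eq_tri => // a; apply: eq_bigr => b _; rewrite mxE mulrC.
Qed.

Lemma act_form_linear g S : S \is 1.-homog ->
  linear_coefs (act_form g S) = (invmx g)^T *m linear_coefs S.
Proof.
move=> S1; apply/matrixP => i j; rewrite (ord1 j) [LHS]mxE [RHS]mxE.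
rewrite /act_form /comp_mpoly linear_mmap // raddf_sum; apply: eq_bigr => a _ /=.
rewrite mul_mpolyC mcoeffZ tnth_mktuple raddf_sum /= [in RHS]mxE mulrC; congr (_ * _).
rewrite (bigD1 i) //= big1 => [|b /negbTE ne_bi]; rewrite mcoeffZ mcoeffXU ?ne_bi ?mulr0 //.
by rewrite eqxx mulr1 addr0.
Qed.

End FormAction.

Lemma map_form_tensor (R S : comNzRingType) (f : {rmorphism R -> S}) c :
  map_tensor f (form_tensor c) =1 form_tensor (f \o c).
Proof. by move=> i; apply/matrixP => j l; rewrite !mxE /= raddfMn. Qed.

Lemma scale_form_tensor (R : comNzRingType) (s : R) c :
  scale_tensor s (form_tensor c) =1 form_tensor (fun n => s * c n).
Proof. by move=> i; apply/matrixP => j l; rewrite !mxE /= mulrnAr. Qed.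

(** Attaching to each variable its weight as a power of a new variable separates the weighted parts
    of [P]. *)
Lemma weighted_homogeneous (R : comNzRingType) n (w : 'I_n -> nat) a (P : {mpoly R[n]}) :
  mmap (polyC \o mpolyC n (R := R)) (fun l => ('X_l)%:P * 'X^(w l)) P = 'X^a * P%:P ->
  forall m, m \in msupp P -> (\sum_l w l * m l = a)%N.
Proof.
have termE (c : R) m : (polyC \o mpolyC n (R := R)) c
      * mmap1 (fun l => ('X_l)%:P * 'X^(w l)) m
    = (c *: 'X_[m])%:P * 'X^(\sum_l w l * m l).
  rewrite -mul_mpolyC polyCM -mulrA; congr (_ * _).
  rewrite /mmap1 (eq_bigr (fun l => ('X_l ^+ m l)%:P * 'X^(w l * m l))).
    rewrite big_split /= -rmorph_prod /= -mpolyXE_id; congr (_ * _).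
    by rewrite -expr_sum.
  move=> l _; rewrite exprMn_comm -?polyC_exp -?exprM //; exact: commr_polyXn.
(* Both sides are compared at the power [N] of the new variable and the monomial [m0]; on the left
   only [m0] itself contributes. *)
move=> wP m0 supp_m0; pose N := (\sum_l w l * m0 l)%N; apply/eqP; rewrite -/N.
have := congr1 (fun p : {poly {mpoly R[n]}} => (p`_N)@_m0) wP.
rewrite /= mulrC coefCM coefXn mulr_natr mcoeffMn /mmap coef_sum raddf_sum /=.
rewrite (bigD1_seq m0) ?msupp_uniq //= big1 => [|m /negbTE ne_m]; last first.
  by rewrite termE coefCM coefXn mulr_natr mcoeffMn mcoeffZ mcoeffX ne_m mulr0 mul0rn.
rewrite termE addr0 coefCM coefXn -/N eqxx mulr1 mcoeffZ mcoeffX eqxx mulr1.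
by case: eqP => // _ /eqP; rewrite mulr0n mcoeff_eq0 supp_m0.
Qed.

Section InvariantSections.
Variable k : fieldType.
Hypothesis six_neq0 : 6%:R != 0 :> k.
Variables (J : pair_form) (n m : nat).
Hypotheses (n_gt0 : (0 < n)%N) (J_inv : relative_invariant J n n m).

Let X l : {mpoly k[10 + 3]} := 'X_l.
(** The cubic whose ten coefficients are variables; [J] at the generic pair is the section as a
    polynomial. *)
Let generic_tensor := form_tensor (fun i => X (lshift 3 (inord i))).
Let generic_linear : 'cV_3 := \col_j X (rshift 10 j).
Let J_poly : {mpoly k[10 + 3]} := J generic_tensor generic_linear.

Lemma generic_map (S : comNzRingType) (f : {rmorphism {mpoly k[10 + 3]} -> S}) :
  f J_poly = J (form_tensor (fun i => f (X (lshift 3 (inord i)))))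
               (\col_j f (X (rshift 10 j))).
Proof.
rewrite -(invariant_map J_inv) (invariant_eq J_inv _ (map_form_tensor _ _)).
by congr (J _ _); apply/matrixP => i j; rewrite !mxE.
Qed.

Lemma generic_eval F S :
  J_poly.@[pair_coords F S] = J (form_tensor (cubic_coefs F)) (linear_coefs S).
Proof.
rewrite generic_map (invariant_eq J_inv (d' := form_tensor (cubic_coefs F))).
  congr (J _ _); apply/matrixP => i j; rewrite !mxE /X /= mevalXU /pair_coords.
  by rewrite (unsplitK (inr i)).
apply: form_tensor_ext => i lt_i; rewrite /X /= mevalXU /pair_coords (unsplitK (inl _)).
by rewrite (tnth_nth 0%MM) inordK.
Qed.

Lemma generic_invariant : SL3_invariant J_poly.
Proof.
move=> g det_g F S F3 S1; rewrite !generic_eval.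
rewrite (invariant_eq J_inv _ (act_form_tensor six_neq0 g F3)) act_form_linear //.
by rewrite (invariant_act J_inv) det_tr det_inv det_g invr1 expr1n mul1r.
Qed.

Lemma generic_bihomogeneous : bihomogeneous n n J_poly.
Proof.
pose weight (s t : nat) (l : 'I_(10 + 3)) := match split l with inl _ => s | inr _ => t end.
have weightl s t i : weight s t (lshift 3 i) = s by rewrite /weight (unsplitK (inl i)).
have weightr s t j : weight s t (rshift 10 j) = t by rewrite /weight (unsplitK (inr j)).
(* [invariant_scale] is used over polynomials in a new variable, whose powers [s] and [t] scale the
   cubic and the line. The choices (1,0) and (0,1) read off the two degrees. *)
have scaled s t mu : mu \in msupp J_poly ->
    (\sum_l weight s t l * mu l = s * n + t * n)%N.
  apply: weighted_homogeneous.
  pose phi : {rmorphism {mpoly k[10 + 3]} -> {poly {mpoly k[10 + 3]}}} :=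
    mmap (polyC \o mpolyC (10 + 3) (R := k)) (fun l => ('X_l)%:P * 'X^(weight s t l)).
  have phiX l : phi (X l) = 'X^(weight s t l) * (X l)%:P by rewrite /= mmapX mmap1U mulrC.
  rewrite -[LHS]/(phi J_poly) generic_map.
  rewrite -[(J_poly)%:P]/(polyC J_poly) (generic_map polyC) exprD !exprM -(invariant_scale J_inv).
  rewrite (invariant_eq J_inv (d' := scale_tensor 'X^s
    (form_tensor (fun i => (X (lshift 3 (inord i)))%:P)))).
    by congr (J _ _); apply/matrixP => i j; rewrite !mxE phiX weightr.
  move=> i; rewrite scale_form_tensor; apply: form_tensor_ext => a _.
  by rewrite phiX weightl.
move=> mu mu_P; split.
  have := scaled 1%N 0%N mu mu_P; rewrite mul1n mul0n addn0 big_split_ord /= => <-.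
  rewrite -[LHS]addn0; congr (_ + _)%N.
    by apply: eq_bigr => i _; rewrite weightl mul1n.
  by rewrite big1 // => j _; rewrite weightr.
have := scaled 0%N 1%N mu mu_P; rewrite mul1n mul0n add0n big_split_ord /= => <-.
apply: esym; rewrite big1 => [|i _]; last by rewrite weightl.
by rewrite add0n; apply: eq_bigr => j _; rewrite weightr mul1n.
Qed.

Lemma unstable_invariant (F S : {mpoly k[3]}) : unstable F S ->
  J (form_tensor (cubic_coefs F)) (linear_coefs S) = 0.
Proof.
move=> FS_unstable; apply/eqP/negPn/negP => J_neq0; apply: FS_unstable.
exists n, J_poly; split=> //; first exact: generic_bihomogeneous.
  exact: generic_invariant.
by rewrite generic_eval.
Qed.

End InvariantSections.

Lemma relative_invariantX J a b m e : relative_invariant J a b m ->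
  relative_invariant (fun R d u => J R d u ^+ e) (a * e) (b * e) (m * e).
Proof.
move=> hJ; split=> *.
- by rewrite (invariant_map hJ) rmorphXn.
- by rewrite (invariant_act hJ) exprMn exprM.
- by rewrite (invariant_scale hJ) !exprMn !exprM.
- by congr (_ ^+ e); apply: (invariant_eq hJ).
Qed.

Lemma unstable_vanishing (k : fieldType) (F S : {mpoly k[3]}) : 6%:R != 0 :> k ->
  unstable F S -> vanishing (form_tensor (cubic_coefs F)) (linear_coefs S).
Proof.
move=> six_neq0 FS_unstable; split.
- exact: (unstable_invariant six_neq0 _ cayleyan_invariant).
- exact: (unstable_invariant six_neq0 _
    (relative_invariantM cayleyan_hessian_invariant dual_form_invariant)).
- exact: (unstable_invariant six_neq0 _
    (relative_invariantM dual_form_hessian_invariant (relative_invariantX 3 dual_form_invariant))).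
- exact: (unstable_invariant six_neq0 _
    (relative_invariantM dual_form_polar_invariant (relative_invariantX 2 dual_form_invariant))).
Qed.

(** * Destabilizing one-parameter subgroups *)

(** The polynomial [p + 1] has no root, so over a closed field it is constant. *)
Lemma poly_zero_everywhere (k : closedFieldType) (p : {poly k}) :
  (forall x, p.[x] = 0) -> p = 0.
Proof.
move=> p0; have /closed_rootP : ~ exists x, root (p + 1) x.
  by case=> x /rootP; rewrite hornerD p0 hornerC add0r => /eqP; rewrite oner_eq0.
move=> /size_poly1P[c _ p1].
have -> : p = (c - 1)%:P by rewrite polyCB -p1 polyC1 addrK.
by have := p0 0; rewrite -[p](addrK 1) p1 hornerD hornerN !hornerC => ->; rewrite polyC0.
Qed.

Lemma mdeg_cubic i : mdeg (tnth cubic_monomials i) = 3%N.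
Proof.
have /allP mdeg3 : all (fun m => mdeg m == 3%N) cubic_monomials.
  by rewrite /= !mdegE !big_ord3 !multinomE !(tnth_nth 0%N).
exact/eqP/mdeg3/mem_tnth.
Qed.

Section OneParameterSubgroup.
Variable k : closedFieldType.
Implicit Types (F S : {mpoly k[3]}) (P : {mpoly k[10 + 3]}).

Lemma mcoeff_comp_scale n (s : 'I_n -> k) (p : {mpoly k[n]}) m :
  (p \mPo [tuple s i *: 'X_i | i < n])@_m = p@_m * \prod_i s i ^+ m i.
Proof.
have termE (a : 'X_{1..n}) : \prod_i tnth [tuple s i *: 'X_i | i < n] i ^+ a i
    = (\prod_i s i ^+ a i) *: 'X_[k, a].
  rewrite -mul_mpolyC rmorph_prod /= mpolyXE_id -big_split /=; apply: eq_bigr => i _.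
  by rewrite tnth_mktuple -mul_mpolyC exprMn rmorphXn.
rewrite comp_mpolyE raddf_sum /=.
under eq_bigr => a _ do rewrite termE !mcoeffZ mcoeffX.
have [m_p|m_p] := boolP (m \in msupp p).
  rewrite (bigD1_seq m) ?msupp_uniq //= [X in _ + X]big1 => [|a /negbTE ->].
    by rewrite eqxx mulr1 addr0.
  by rewrite !mulr0.
rewrite (memN_msupp_eq0 m_p) mul0r big1_seq // => a /andP[_ a_p].
by case: eqP => [eq_a|]; rewrite ?mulr0 //; rewrite eq_a (negbTE m_p) in a_p.
Qed.

Lemma act_diag_coef (s : 'I_3 -> k) F m : (forall i, s i != 0) ->
  (act_form (diag_mx (\row_i (s i)^-1)) F)@_m = F@_m * \prod_i s i ^+ m i.
Proof.
move=> s_neq0; rewrite -mcoeff_comp_scale /act_form; congr (_ \mPo _)@__.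
have -> : invmx (diag_mx (\row_i (s i)^-1)) = diag_mx (\row_i s i).
  have inv_s : diag_mx (\row_i s i) *m diag_mx (\row_i (s i)^-1) = 1%:M.
    apply/matrixP => i j; rewrite mulmx_diag !mxE.
    by case: eqP => [->|]; rewrite ?mulr0n // mulfV.
  have [unit_s unit_s'] := mulmx1_unit inv_s.
  by rewrite -[RHS]mulmx1 -(mulmxV unit_s') mulmxA inv_s mul1mx.
apply: eq_from_tnth => i; rewrite !tnth_mktuple (bigD1 i) //= big1 => [|j ne_ji].
  by rewrite !mxE eqxx addr0.
by rewrite !mxE eq_sym (negbTE ne_ji) scale0r.
Qed.

Lemma bihomogeneous_scale a b P x y (v : 'I_(10 + 3) -> k) : bihomogeneous a b P ->
  P.@[fun l => match split l with inl _ => x | inr _ => y end * v l]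
  = x ^+ a * y ^+ b * P.@[v].
Proof.
move=> P_ab; rewrite !mevalE mulr_sumr !big_seq; apply: eq_bigr => m /P_ab[sum_a sum_b].
rewrite mulrCA; congr (_ * _).
under eq_bigr => l _ do rewrite exprMn.
rewrite big_split /=; congr (_ * _).
rewrite big_split_ord /=; congr (_ * _).
  by rewrite -sum_a expr_sum; apply: eq_bigr => i _; rewrite (unsplitK (inl i)).
by rewrite -sum_b expr_sum; apply: eq_bigr => j _; rewrite (unsplitK (inr j)).
Qed.

(** The true weights are [e i - c], with sum zero; the shift keeps exponents natural and adds 3c to
    cubic monomials and c to linear ones, hence 4c. The inequality says that the subgroup contracts
    the pair to 0 as t tends to 0. *)
Lemma one_parameter_unstable F S (e : 'I_3 -> nat) c minF minS :
  F \is 3.-homog -> S \is 1.-homog ->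
  (\sum_i e i = 3 * c)%N -> (4 * c < minF + minS)%N ->
  (forall m, F@_m != 0 -> (minF <= \sum_i e i * m i)%N) ->
  (forall j, S@_(U_(j))%MM != 0 -> (minS <= e j)%N) ->
  unstable F S.
Proof.
move=> F3 S1 sum_e lt_c leF leS [n [P [n_gt0 P_bihom P_inv]]]; apply/negP/negPn.
pose v := pair_coords F S.
pose E (l : 'I_(10 + 3)) := match split l with
  | inl i => \sum_j e j * tnth cubic_monomials i j | inr j => e j end%N.
(* The section along the curve of rescaled coefficients, as a polynomial in t. Invariance forces it
   to be [P.@[v]] times t^(4cn), while its lowest possible exponent is larger. *)
pose psi : {poly k} := mmap polyC (fun l => v l *: 'X^(E l)) P.
have psiE t : psi.[t] = P.@[fun l => v l * t ^+ E l].
  rewrite /psi /mmap horner_sum mevalE; apply: eq_bigr => m _.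
  rewrite hornerM hornerC /mmap1 horner_prod; congr (_ * _); apply: eq_bigr => l _.
  by rewrite horner_exp hornerZ hornerXn.
have psi_curve t : t != 0 -> psi.[t] = t ^+ (4 * c * n) * P.@[v].
  move=> t_neq0; pose s i := t ^+ e i / t ^+ c.
  have s_neq0 i : s i != 0 by rewrite mulf_neq0 ?invr_eq0 ?expf_neq0.
  pose g := diag_mx (\row_i (s i)^-1).
  have det_g : \det g = 1.
    rewrite det_diag; under eq_bigr => i _ do rewrite mxE.
    rewrite prodfV /s big_split /= -expr_sum sum_e prodfV prodr_const card_ord -exprM.
    by rewrite mulnC mulfV ?invr1 // expf_neq0.
  rewrite -(P_inv g det_g F S F3 S1) psiE.
  have -> : t ^+ (4 * c * n) = (t ^+ (3 * c)) ^+ n * (t ^+ c) ^+ n.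
    by rewrite -!exprM -exprD; congr (_ ^+ _); ring.
  rewrite -bihomogeneous_scale //; apply: meval_eq => l.
  rewrite /v /E /pair_coords; case: (split l) => [i|j]; rewrite act_diag_coef //.
    rewrite mulrCA; congr (_ * _); rewrite /s.
    under [in RHS]eq_bigr => j _ do rewrite exprMn -exprM exprVn -exprM.
    rewrite big_split /= expr_sum prodfV -!expr_sum -[X in _ / _ ^+ X]big_distrr /=.
    rewrite -mdegE mdeg_cubic.
    by rewrite [in RHS]mulnC mulrC divfK // expf_neq0.
  rewrite mulrCA; congr (_ * _); rewrite (bigD1 j) //= big1 => [|i /negbTE ne_ij].
    by rewrite mnm1E eqxx expr1 mulr1 /s mulrC divfK // expf_neq0.
  by rewrite mnm1E eq_sym ne_ij.
have psi_eq : psi = P.@[v] *: 'X^(4 * c * n).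
  (* The identity is known only for nonzero t; the factor ['X] takes care of t = 0. *)
  have /eqP : (psi - P.@[v] *: 'X^(4 * c * n)) * 'X = 0.
    apply: poly_zero_everywhere => t; rewrite hornerM hornerX hornerD hornerN hornerZ hornerXn.
    have [->|t_neq0] := eqVneq t 0; first by rewrite mulr0.
    by rewrite psi_curve // [P.@[v] * _]mulrC subrr mul0r.
  by rewrite mulf_eq0 polyX_eq0 orbF subr_eq0 => /eqP.
have : psi`_(4 * c * n) = P.@[v] by rewrite psi_eq coefZ coefXn eqxx mulr1.
move <-; apply/eqP; rewrite /psi /mmap coef_sum big1_seq // => m /andP[_ /P_bihom[sumF sumS]].
rewrite coefCM /mmap1.
have -> : \prod_l (v l *: 'X^(E l)) ^+ m l = (\prod_l v l ^+ m l) *: 'X^(\sum_l E l * m l).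
  rewrite -mul_polyC rmorph_prod expr_sum -big_split /=; apply: eq_bigr => l _.
  by rewrite -mul_polyC exprMn_comm -?polyC_exp -?exprM //; exact: commr_polyXn.
rewrite coefZ coefXn; case: eqP => [eq_w|_]; last by rewrite !mulr0.
suff -> : \prod_l v l ^+ m l = 0 by rewrite mul0r mulr0.
apply/eqP/negPn/negP => prod_neq0.
have v_neq0 l : (0 < m l)%N -> v l != 0.
  move=> m_l; apply: contra prod_neq0 => /eqP v_l; rewrite (bigD1 l) //= v_l.
  by rewrite expr0n -(prednK m_l) mul0r.
(* A surviving monomial has [n] factors from the cubic and [n] from the line, each of at least the
   minimal weight. *)
have : (n * (minF + minS) <= \sum_l E l * m l)%N.
  rewrite mulnDr -{1}sumF -sumS !big_distrl big_split_ord /=.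
  have le_term l (lo : nat) : (v l != 0 -> (lo <= E l)%N) -> (m l * lo <= E l * m l)%N.
    by move=> le_lo; case: (posnP (m l)) => [->//|/v_neq0/le_lo]; rewrite mulnC leq_mul2r orbC => ->.
  apply: leq_add; apply: leq_sum => l _; apply: le_term.
    by rewrite /v /E /pair_coords (unsplitK (inl l)); apply: leF.
  by rewrite /v /E /pair_coords (unsplitK (inr l)); apply: leS.
by rewrite -eq_w -[(4 * c * n)%N]mulnC leq_pmul2l // leqNgt lt_c.
Qed.

End OneParameterSubgroup.

Section DegenerateUnstable.
Variable k : closedFieldType.
Hypothesis six_neq0 : 6%:R != 0 :> k.
Implicit Types (F S : {mpoly k[3]}).

Let tensor_of F := form_tensor (cubic_coefs F).

Lemma act_diag (s : 'rV[k]_3) (d : tensor k) i j l :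
  act (diag_mx s) d i j l = s 0 i * s 0 j * s 0 l * d i j l.
Proof.
rewrite /act tr_diag_mx mul_mx_diag mul_diag_mx !mxE summxE (bigD1 i) //= big1 => [|a ne_ai].
  by rewrite !mxE eqxx mulr1n addr0; ring.
by rewrite !mxE eq_sym (negbTE ne_ai) mul0r.
Qed.

Lemma unstable_change_basis (b : 'M[k]_3) F S :
  F \is 3.-homog -> S \is 1.-homog -> \det b = 1 ->
  (forall F' S', F' \is 3.-homog -> S' \is 1.-homog ->
    tensor_of F' =1 act b (tensor_of F) -> linear_coefs S' = b *m linear_coefs S ->
    unstable F' S') ->
  unstable F S.
Proof.
move=> F3 S1 det_b unst [n [P [n_gt0 P_bihom P_inv]]]; pose g := invmx b^T.
have g_inv : (invmx g)^T = b by rewrite invmxK trmxK.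
have det_g : \det g = 1 by rewrite det_inv det_tr det_b invr1.
rewrite -(P_inv g det_g F S F3 S1) => P_neq0.
apply: (unst (act_form g F) (act_form g S)); rewrite ?act_form_homog //.
- by move=> i; rewrite /tensor_of act_form_tensor // g_inv.
- by rewrite act_form_linear // g_inv.
by exists n, P; split.
Qed.

Lemma form_tensor_coef F i j l n w :
  tensor_of F i j l = cubic_coefs F n *+ w -> (w %| 6)%N -> tensor_of F i j l = 0 ->
  cubic_coefs F n = 0.
Proof.
move=> -> /dvdnP[q eq6] /eqP; rewrite -mulr_natr mulf_eq0 => /orP[/eqP //|w0].
by case/negP: six_neq0; rewrite eq6 natrM (eqP w0) mulr0.
Qed.

Lemma cubic_support F m : F \is 3.-homog -> F@_m != 0 ->
  exists2 n, (n < 10)%N & m = nth 0%MM cubic_monomials n /\ cubic_coefs F n != 0.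
Proof.
move=> /dhomogP F3 m_F; have m_supp : m \in msupp F by rewrite mcoeff_msupp.
have m_in := cubic_monomialsP (F3 m m_supp).
exists (index m cubic_monomials); first by rewrite -[10%N]/(size cubic_monomials) index_mem.
by rewrite /cubic_coefs nth_index.
Qed.

Lemma cubic_support_le F (e : 'I_3 -> nat) lo : F \is 3.-homog ->
  (forall n, (n < 10)%N -> cubic_coefs F n != 0 ->
    (lo <= nth 0 [:: e o0 * 3; e o1 * 3; e o2 * 3; e o0 * 2 + e o1; e o0 * 2 + e o2;
      e o0 + e o1 * 2; e o1 * 2 + e o2; e o0 + e o2 * 2; e o1 + e o2 * 2; e o0 + e o1 + e o2] n)%N) ->
  forall m, F@_m != 0 -> (lo <= \sum_i e i * m i)%N.
Proof.
move=> F3 le_lo m /(cubic_support F3) [n lt_n [-> c_n]]; apply: leq_trans (le_lo n lt_n c_n) _.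
rewrite big_ord3; move: n lt_n {c_n} => [|[|[|[|[|[|[|[|[|[|n]]]]]]]]]] // _ /=;
  rewrite !multinomE !(tnth_nth 0%N) /= ?muln0 ?muln1 ?addr0 ?add0r //.
Qed.

(* The weights of the coordinates are (-3, -1, 4), shifted by 3. *)
Lemma flex_unstable F S : F \is 3.-homog -> S \is 1.-homog ->
  linear_coefs S o0 0 = 0 -> linear_coefs S o1 0 = 0 ->
  tensor_of F o0 o0 o0 = 0 -> tensor_of F o0 o0 o1 = 0 -> tensor_of F o0 o1 o1 = 0 ->
  unstable F S.
Proof.
move=> F3 S1 S0 S1' F000 F001 F011.
have c0 : cubic_coefs F 0 = 0 by apply: form_tensor_coef F000; rewrite ?mxE.
have c3 : cubic_coefs F 3 = 0 by apply: form_tensor_coef F001; rewrite ?mxE.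
have c5 : cubic_coefs F 5 = 0 by apply: form_tensor_coef F011; rewrite ?mxE.
apply: (@one_parameter_unstable _ F S (fun i => nth 0 [:: 0; 2; 7] i)%N 3 6 7) => //.
- by rewrite big_ord3.
- apply: cubic_support_le => // -[|[|[|[|[|[|[|[|[|[|n]]]]]]]]]] // _;
  by rewrite ?c0 ?c3 ?c5 ?eqxx.
by apply: forall_ord3 => //; [move: S0 | move: S1']; rewrite mxE => ->; rewrite eqxx.
Qed.

(* The weights of the coordinates are (-2, 1, 1), shifted by 2. *)
Lemma singular_unstable F S : F \is 3.-homog -> S \is 1.-homog ->
  linear_coefs S o0 0 = 0 -> (forall i, tensor_of F o0 o0 i = 0) -> unstable F S.
Proof.
move=> F3 S1 S0 F00.
have c0 : cubic_coefs F 0 = 0 by apply: form_tensor_coef (F00 o0); rewrite ?mxE.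
have c3 : cubic_coefs F 3 = 0 by apply: form_tensor_coef (F00 o1); rewrite ?mxE.
have c4 : cubic_coefs F 4 = 0 by apply: form_tensor_coef (F00 o2); rewrite ?mxE.
apply: (@one_parameter_unstable _ F S (fun i => nth 0 [:: 0; 3; 3] i)%N 2 6 3) => //.
- by rewrite big_ord3.
- apply: cubic_support_le => // -[|[|[|[|[|[|[|[|[|[|n]]]]]]]]]] // _;
  by rewrite ?c0 ?c3 ?c4 ?eqxx.
by apply: forall_ord3 => //; move: S0; rewrite mxE => ->; rewrite eqxx.
Qed.

(* The weights of the coordinates are (1, 1, -2), shifted by 2. *)
Lemma triple_point_unstable F S : F \is 3.-homog -> S \is 1.-homog ->
  (forall i j, tensor_of F o2 i j = 0) -> unstable F S.
Proof.
move=> F3 S1 F2.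
have c2 : cubic_coefs F 2 = 0 by apply: form_tensor_coef (F2 o2 o2); rewrite ?mxE.
have c4 : cubic_coefs F 4 = 0 by apply: form_tensor_coef (F2 o0 o0); rewrite ?mxE.
have c6 : cubic_coefs F 6 = 0 by apply: form_tensor_coef (F2 o1 o1); rewrite ?mxE.
have c7 : cubic_coefs F 7 = 0 by apply: form_tensor_coef (F2 o2 o0); rewrite ?mxE.
have c8 : cubic_coefs F 8 = 0 by apply: form_tensor_coef (F2 o2 o1); rewrite ?mxE.
have c9 : cubic_coefs F 9 = 0 by apply: form_tensor_coef (F2 o0 o1); rewrite ?mxE.
apply: (@one_parameter_unstable _ F S (fun i => nth 0 [:: 3; 3; 0] i)%N 2 9 0) => //.
- by rewrite big_ord3.
apply: cubic_support_le => // -[|[|[|[|[|[|[|[|[|[|n]]]]]]]]]] // _;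
by rewrite ?c2 ?c4 ?c6 ?c7 ?c8 ?c9 ?eqxx.
Qed.

Theorem degenerate_unstable F S : F \is 3.-homog -> S \is 1.-homog ->
  degenerate (tensor_of F) (linear_coefs S) -> unstable F S.
Proof.
(* Rescaling the last row brings the basis into SL(3); a diagonal change preserves every vanishing
   condition. *)
move=> F3 S1 degen; pose s (b : 'M[k]_3) : 'rV[k]_3 := \row_i (if i == o2 then (\det b)^-1 else 1).
have det_sb b : b \in unitmx -> \det (diag_mx (s b) *m b) = 1.
  rewrite unitmxE unitfE => det_b; rewrite det_mulmx det_diag !big_ord_recl big_ord0 !mxE /=.
  by rewrite !mul1r mulr1 mulVf.
have actE b F' : tensor_of F' =1 act (diag_mx (s b) *m b) (tensor_of F) ->
    forall i j l, tensor_of F' i j l = s b 0 i * s b 0 j * s b 0 l * act b (tensor_of F) i j l.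
  by move=> eqF i j l; rewrite eqF -act_mul act_diag.
have linE b S' i : linear_coefs S' = diag_mx (s b) *m b *m linear_coefs S ->
    linear_coefs S' i 0 = s b 0 i * (b *m linear_coefs S) i 0.
  by move=> ->; rewrite -mulmxA mul_diag_mx mxE.
case: degen => [[b unitb [S0 S1' F000 F001 F011]]|[b unitb [S0 F00]]|[b unitb F2]];
  apply: (unstable_change_basis F3 S1 (det_sb b unitb)) => F' S' F'3 S'1 eqF eqS.
- by apply: flex_unstable; rewrite // ?(actE b) ?(linE b) // ?F000 ?F001 ?F011 ?S0 ?S1' mulr0.
- apply: singular_unstable; rewrite // ?(linE b) ?S0 ?mulr0 // => i.
  by rewrite (actE b) // F00 mulr0.
by apply: triple_point_unstable => // i j; rewrite (actE b) // F2 mulr0.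
Qed.

End DegenerateUnstable.

(** * Multiplicity and tangency *)

Section TrilinearExpansions.
Variable R : comNzRingType.
Implicit Types (d : tensor R) (x y z : 'I_3 -> R).

Lemma tri_map (S : comNzRingType) (f : {rmorphism R -> S}) d x y z :
  tri (map_tensor f d) (f \o x) (f \o y) (f \o z) = f (tri d x y z).
Proof.
rewrite /tri rmorph_sum; apply: eq_bigr => i _; rewrite rmorph_sum; apply: eq_bigr => j _.
by rewrite rmorph_sum; apply: eq_bigr => l _; rewrite !rmorphM mxE.
Qed.

Lemma map_tensor_sym (S : comNzRingType) (f : R -> S) d :
  symmetric_tensor d -> symmetric_tensor (map_tensor f d).
Proof. by move=> d_sym i j l; rewrite !mxE; case: (d_sym i j l) => <- <-. Qed.

Lemma tri_binomial d x y (t : R) : symmetric_tensor d ->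
  let z := fun i => x i + t * y i in
  tri d z z z = tri d x x x + 3%:R * t * tri d x x y + 3%:R * t ^+ 2 * tri d x y y
                + t ^+ 3 * tri d y y y.
Proof. by move=> d_sym z; rewrite /z /tri !big_ord3 !(tensor_sort d_sym); ring. Qed.

Lemma triC12 d x y z : symmetric_tensor d -> tri d x y z = tri d y x z.
Proof. by move=> d_sym; rewrite /tri !big_ord3 !(tensor_sort d_sym); ring. Qed.

Lemma triC23 d x y z : symmetric_tensor d -> tri d x y z = tri d x z y.
Proof. by move=> d_sym; rewrite /tri !big_ord3 !(tensor_sort d_sym); ring. Qed.

Lemma tri_lin3 d x y z z' (t : R) :
  tri d x y (fun i => z i + t * z' i) = tri d x y z + t * tri d x y z'.
Proof. by rewrite /tri !big_ord3; ring. Qed.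

Lemma tri_binomial2 d w x y (t : R) : symmetric_tensor d ->
  let z := fun i => x i + t * y i in
  tri d w z z = tri d w x x + 2%:R * t * tri d w x y + t ^+ 2 * tri d w y y.
Proof. by move=> d_sym z; rewrite /z /tri !big_ord3 !(tensor_sort d_sym); ring. Qed.

Lemma tri_coord3 d x y z : tri d x y z = \sum_i z i * tri d x y (1%:M i).
Proof.
rewrite -(tri_sum3 1%:M); apply: eq_tri => // a.
by rewrite (bigD1 a) //= big1 => [|i /negbTE ne]; rewrite mxE ?eqxx ?ne ?mulr0 // mulr1 addr0.
Qed.

End TrilinearExpansions.

Section Order.
Variables (k : fieldType) (n : nat).
Implicit Types f g : {mpoly k[n]}.

Lemma mpoly_order_le f m : m \in msupp f -> (mpoly_order f <= mdeg m)%N.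
Proof.
rewrite /mpoly_order; elim: (msupp f) => // a s IHs; rewrite inE big_cons.
by case/predU1P => [->|/IHs]; rewrite geq_min ?leqnn // => ->; rewrite orbT.
Qed.

Lemma mpoly_order_attained f : f != 0 -> exists2 m, m \in msupp f & mdeg m = mpoly_order f.
Proof.
move=> f_neq0.
(* The default value [msize f] exceeds the degree of every monomial, so for nonzero [f] it cannot be
   the minimum. *)
suff [order_max|//] : mpoly_order f = msize f \/ exists2 m, m \in msupp f & mdeg m = mpoly_order f.
  have m_f := mlead_supp f_neq0; have := mpoly_order_le m_f.
  by rewrite order_max leqNgt (msize_mdeg_lt m_f).
rewrite /mpoly_order; elim: (msupp f) => [|a s IHs]; first by left; rewrite big_nil.
rewrite big_cons /minn; case: ifP => _; first by right; exists a; rewrite ?inE ?eqxx.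
by case: IHs => [|[m m_s <-]]; [left | right; exists m; rewrite ?inE ?m_s ?orbT].
Qed.

Variables (f : {mpoly k[n]}) (c : k) (g : nat -> {mpoly k[n]}).
Hypotheses (c_neq0 : c != 0) (g_homog : forall j, g j \is j.-homog).
Hypotheses (f_neq0 : f != 0) (f_sum : c *: f = \sum_(j < 4) g j).

Lemma coef_homog_sum m : c * f@_m = if (mdeg m < 4)%N then (g (mdeg m))@_m else 0.
Proof.
rewrite -mcoeffZ f_sum raddf_sum /=.
have g0 j : mdeg m != j -> (g j)@_m = 0 by exact: dhomog_nemf_coeff.
case: ifP => [lt_m|ge_m]; last first.
  by apply: big1 => j _; apply: g0; apply: contraFneq ge_m => ->.
by rewrite (bigD1 (Ordinal lt_m)) //= big1 ?addr0 // => j ne_j; apply: g0; rewrite eq_sym.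
Qed.

Lemma lt_order_homog_eq0 j : (j < mpoly_order f)%N -> (j < 4)%N -> g j = 0.
Proof.
move=> lt_j lt4; apply/mpolyP => m; rewrite mcoeff0.
have [eq_m|ne_m] := eqVneq (mdeg m) j; last exact: dhomog_nemf_coeff ne_m.
have := coef_homog_sum m; rewrite eq_m lt4 => <-.
have [m_f|m_f] := boolP (m \in msupp f); last by rewrite memN_msupp_eq0 // mulr0.
by have := mpoly_order_le m_f; rewrite eq_m leqNgt lt_j.
Qed.

Lemma order_homog_sum_lt4 : (mpoly_order f < 4)%N.
Proof.
have [m m_f <-] := mpoly_order_attained f_neq0; rewrite ltnNge; apply/negP => ge4.
have := coef_homog_sum m; rewrite ltnNge ge4 /= => /eqP.
by rewrite mulf_eq0 (negbTE c_neq0) /= mcoeff_eq0 m_f.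
Qed.

Lemma homog_eq0_le_order r : (forall j, (j < r)%N -> g j = 0) -> (r <= mpoly_order f)%N.
Proof.
move=> g0; have [m m_f <-] := mpoly_order_attained f_neq0; rewrite leqNgt; apply/negP => lt_r.
have := coef_homog_sum m; rewrite g0 // mcoeff0 if_same => /eqP.
by rewrite mulf_eq0 (negbTE c_neq0) /= mcoeff_eq0 m_f.
Qed.

End Order.

Section Multiplicity.
Variable k : fieldType.
Hypothesis six_neq0 : 6%:R != 0 :> k.
Variables (F : {mpoly k[3]}) (p : 'rV[k]_3).
Hypotheses (F3 : F \is 3.-homog) (F_neq0 : F != 0) (p_neq0 : p != 0).

Let d := form_tensor (cubic_coefs F).
Let d_sym : symmetric_tensor d := form_tensor_sym _.

Let pnorm (i : 'I_3) : 'I_3 -> k := fun l => p 0 l / p 0 i.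
Let Y (i : 'I_3) : 'I_3 -> {mpoly k[2]} := fun l =>
  if unlift i l is Some j then 'X_j else 0.
Let lift_const (x : 'I_3 -> k) : 'I_3 -> {mpoly k[2]} := mpolyC 2 (R := k) \o x.
Let D := map_tensor (mpolyC 2 (R := k)) d.

(** Taylor expansion at the point: the part of degree [j] of 6 times the local equation, with
    [pnorm i] the point scaled to have coordinate [i] equal to 1 and [Y i] the displacement in the
    chart. *)
Let part i j : {mpoly k[2]} :=
  let q := lift_const (pnorm i) in
  nth 0 [:: tri D q q q; 3%:R * tri D q q (Y i); 3%:R * tri D q (Y i) (Y i);
            tri D (Y i) (Y i) (Y i)] j.

Let equation (i : 'I_3) : {mpoly k[2]} :=
  dehomogenize i F \mPo [tuple 'X_j + (p 0 (lift i j) / p 0 i)%:MP | j < 2].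

Lemma equation_sum i : p 0 i != 0 -> 6%:R *: equation i = \sum_(j < 4) part i j.
Proof.
move=> pi; rewrite scaler_nat /equation; set t := [tuple _ | _ < 2].
pose phi : {rmorphism {mpoly k[2]} -> {mpoly k[2]}} := comp_mpoly t.
transitivity (phi (dehomogenize i F *+ 6)); first by rewrite raddfMn.
rewrite (cubic_mmap (mpolyC 2 (R := k)) _ F3) -(tri_map phi).
set q := lift_const (pnorm i).
(* After translation the chart coordinates are point plus displacement; the scalar 1 matches
   [tri_binomial]. *)
rewrite (eq_tri (d' := D) (x' := fun l => q l + 1 * Y i l)
  (y' := fun l => q l + 1 * Y i l) (z' := fun l => q l + 1 * Y i l)); last 4 first.
- by move=> a; apply/matrixP => b c; rewrite !mxE /phi /= comp_mpolyC.
all: try by move=> l; rewrite /= tnth_mktuple /phi /q /lift_const /Y mul1r /=;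
  case: unliftP => [j ->|->] /=;
  [rewrite comp_mpolyXU -tnth_nth tnth_mktuple addrC | rewrite comp_mpoly1 /pnorm mulfV ?addr0].
rewrite tri_binomial; last exact: map_tensor_sym.
by rewrite !big_ord_recr big_ord0 /part /= -/q; ring.
Qed.

Lemma part_homog i j : part i j \is j.-homog.
Proof.
have constH c : (c%:MP : {mpoly k[2]}) \is 0.-homog.
  by rewrite -[c%:MP]mul1r mulrC mul_mpolyC dhomogZ // dhomog1.
have YH l : Y i l \is 1.-homog.
  by rewrite /Y; case: unlift => [a|]; rewrite ?dhomog0 // dhomogX; apply/eqP/mdeg1.
have natH e a (g : {mpoly k[2]}) : g \is e.-homog -> a%:R * g \is e.-homog.
  by move=> gH; rewrite mulr_natl rpredMn.
have triH x y z r s t : (forall l, x l \is r.-homog) -> (forall l, y l \is s.-homog) ->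
    (forall l, z l \is t.-homog) -> tri D x y z \is (r + s + t).-homog.
  move=> xH yH zH; do 3!(apply: rpred_sum => ? _).
  rewrite mxE -[(r + s + t)%N]addn0; apply: dhomogM; last exact: constH.
  by apply: dhomogM => //; apply: dhomogM.
have qH l : lift_const (pnorm i) l \is 0.-homog := constH _.
rewrite /part; case: j => [|[|[|[|j]]]] /=; rewrite ?nth_nil ?dhomog0 //.
- exact: (triH _ _ _ 0 0 0)%N.
- by apply: natH; apply: (triH _ _ _ 0 0 1)%N.
- by apply: natH; apply: (triH _ _ _ 0 1 1)%N.
- exact: (triH _ _ _ 1 1 1)%N.
Qed.

Let spread (i : 'I_3) (y : 'I_3 -> k) : 'I_2 -> k := fun j => y (lift i j).

Lemma Y_eval i y l : y i = 0 -> (Y i l).@[spread i y] = y l.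
Proof.
move=> yi; rewrite /Y; case: unliftP => [j ->|->]; first by rewrite mevalXU.
by rewrite meval0 yi.
Qed.

Lemma part_eval i j y : y i = 0 ->
  (part i j).@[spread i y] =
  let q := pnorm i in
  nth 0 [:: tri d q q q; 3%:R * tri d q q y; 3%:R * tri d q y y; tri d y y y] j.
Proof.
move=> yi; pose ev : {rmorphism {mpoly k[2]} -> k} := meval (spread i y).
have evD : map_tensor ev D =1 d by move=> a; apply/matrixP => b c; rewrite !mxE /= mevalC.
have evq : ev \o lift_const (pnorm i) =1 pnorm i by move=> l; rewrite /= mevalC.
have evY : ev \o Y i =1 y by move=> l; rewrite /= Y_eval.
have ev3 : ev 3%:R = 3%:R by rewrite rmorph_nat.
rewrite -[LHS]/(ev (part i j)) /part.
have t0 := eq_tri evD evq evq evq; have t1 := eq_tri evD evq evq evY.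
have t2 := eq_tri evD evq evY evY; have t3 := eq_tri evD evY evY evY.
case: j => [|[|[|[|j]]]] /=; rewrite ?nth_nil ?rmorph0 //.
- by rewrite -[LHS](tri_map ev).
- by rewrite -[LHS]/(ev _) rmorphM ev3 -(tri_map ev) t1.
- by rewrite -[LHS]/(ev _) rmorphM ev3 -(tri_map ev) t2.
- by rewrite -[LHS](tri_map ev).
Qed.

Lemma tri_scale1 (e : tensor k) (t : k) x y z : tri e (fun i => t * x i) y z = t * tri e x y z.
Proof. by rewrite /tri !big_ord3; ring. Qed.

Lemma tri_pnorm i x y : p 0 i != 0 -> tri d (p 0) x y = p 0 i * tri d (pnorm i) x y.
Proof.
move=> pi; rewrite -tri_scale1; apply: eq_tri => // l.
by rewrite /pnorm mulrCA mulfV ?mulr1.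
Qed.

(** The local equation sees only displacements with coordinate [i] zero; every other vector differs
    from one of these by a multiple of the point. *)
Lemma split_coord i x : p 0 i != 0 ->
  exists2 y : 'I_3 -> k, y i = 0 & x =1 (fun l => y l + x i * pnorm i l).
Proof.
move=> pi; exists (fun l => x l - x i * pnorm i l) => [|l]; last by rewrite subrK.
by rewrite /pnorm mulfV // mulr1 subrr.
Qed.

Lemma two_three_neq0 : (2%:R != 0 :> k) && (3%:R != 0 :> k).
Proof. by rewrite -negb_or -mulf_eq0 -natrM. Qed.

(** The right side says that the gradient of [F] vanishes at the point: degree 0 gives the direction
    of the point itself, degree 1 the displacements in the chart. *)
Lemma part_singular i : p 0 i != 0 ->
  part i 0 = 0 /\ part i 1 = 0 <-> forall x, tri d (p 0) (p 0) x = 0.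
Proof.
move=> pi; have /andP[nz2 nz3] := two_three_neq0.
have zero_i : (fun=> 0 : k) i = 0 by [].
split=> [[part0 part1] x|sing].
  have [y yi eq_x] := split_coord x pi.
  rewrite (tri_pnorm _ _ pi) triC12 // (tri_pnorm _ _ pi) (eq_tri (frefl d) (frefl _) (frefl _) eq_x) tri_lin3.
  have := @part_eval i 0 (fun=> 0) zero_i; rewrite part0 meval0 /= => <-.
  have /eqP := part_eval 1 yi; rewrite part1 meval0 eq_sym mulf_eq0 (negbTE nz3) /= => /eqP ->.
  by rewrite !mulr0 addr0 !mulr0.
have qq x : tri d (pnorm i) (pnorm i) x = 0.
  have /eqP := sing x; rewrite (tri_pnorm _ _ pi) triC12 // (tri_pnorm _ _ pi) !mulf_eq0 (negbTE pi) /=.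
  by move/eqP.
(* Vanishing on vectors over [k] extends to vectors over the polynomial ring by linearity, through
   the standard basis. *)
have qqR x : tri D (lift_const (pnorm i)) (lift_const (pnorm i)) x = 0.
  rewrite tri_coord3 big1 // => l _.
  rewrite (eq_tri (z' := lift_const (1%:M l)) (frefl D) (frefl _) (frefl _)).
    by rewrite /D /lift_const tri_map qq rmorph0 mulr0.
  by move=> a; rewrite /lift_const /= !mxE mpolyCMn mpolyC1.
by split; rewrite /part /= qqR // mulr0.
Qed.

Lemma part_triple i : p 0 i != 0 ->
  [/\ part i 0 = 0, part i 1 = 0 & part i 2 = 0] <-> forall x y, tri d (p 0) x y = 0.
Proof.
move=> pi; have /andP[nz2 nz3] := two_three_neq0.
split=> [[part0 part1 part2]|trip].
  have /(part_singular pi) sing := conj part0 part1.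
  have qq x : tri d (pnorm i) (pnorm i) x = 0.
    have /eqP := sing x; rewrite (tri_pnorm _ _ pi) triC12 // (tri_pnorm _ _ pi) !mulf_eq0 (negbTE pi) /=.
    by move/eqP.
  have qyy y : y i = 0 -> tri d (pnorm i) y y = 0.
    move=> yi; have /eqP := part_eval 2 yi.
    by rewrite part2 meval0 eq_sym mulf_eq0 (negbTE nz3) /= => /eqP.
  have qxx x : tri d (pnorm i) x x = 0.
    have [y yi eq_x] := split_coord x pi.
    rewrite (eq_tri (frefl d) (frefl _) eq_x eq_x) tri_binomial2 // qyy //.
    by rewrite [tri d _ y _]triC23 // !qq !mulr0 !addr0.
  move=> x y; rewrite (tri_pnorm _ _ pi).
  suff -> : tri d (pnorm i) x y = 0 by rewrite mulr0.
  (* The bilinear form is recovered from its quadratic values at x, y and x + y. *)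
  apply: (mulfI nz2); rewrite mulr0.
  by have := qxx (fun l => x l + 1 * y l); rewrite tri_binomial2 // !qxx mulr1 mulr0 addr0 add0r.
have /(part_singular pi) [part0 part1] := trip (p 0).
have qR x y : tri D (lift_const (pnorm i)) x y = 0.
  have one_const l : (1%:M : 'M[{mpoly k[2]}]_3) l =1 lift_const ((1%:M : 'M[k]_3) l).
    by move=> a; rewrite /lift_const /= !mxE mpolyCMn mpolyC1.
  rewrite tri_coord3 big1 // => l _; rewrite triC23; last exact: map_tensor_sym.
  rewrite tri_coord3 big1 ?mulr0 // => m _.
  rewrite (eq_tri (frefl D) (frefl _) (one_const l) (one_const m)) /D /lift_const tri_map.
  have /eqP := trip (1%:M l) (1%:M m); rewrite (tri_pnorm _ _ pi) mulf_eq0 (negbTE pi) /=.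
  by move=> /eqP ->; rewrite rmorph0 mulr0.
by split=> //; rewrite /part /= qR mulr0.
Qed.

(** If all four homogeneous parts vanish, so does the trilinear form on every vector, and
    polarization gives [F = 0]. *)
Lemma equation_neq0 i : p 0 i != 0 -> equation i != 0.
Proof.
move=> pi; apply: contraNneq F_neq0 => eq0.
have part0 j : (j < 4)%N -> part i j = 0.
  move=> lt4; apply/mpolyP => m; rewrite mcoeff0.
  have [eq_m|ne_m] := eqVneq (mdeg m) j; last exact: dhomog_nemf_coeff (part_homog i j) ne_m.
  have := coef_homog_sum (part_homog i) (equation_sum pi) m.
  by rewrite eq0 mcoeff0 mulr0 eq_m lt4 => <-.
have trip : forall x y, tri d (p 0) x y = 0 by apply/(part_triple pi); split; exact: part0.
have q0 x y : tri d (pnorm i) x y = 0.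
  by have /eqP := trip x y; rewrite (tri_pnorm _ _ pi) mulf_eq0 (negbTE pi) /= => /eqP.
have d0 a b c : d a b c = (fun=> 0 : 'M[k]_3) a b c.
  apply: (tensor_eq_cubes six_neq0 d_sym) => [{}a {}b {}c|x]; first by rewrite !mxE.
  have [y yi eq_x] := split_coord x pi; rewrite (eq_tri (frefl d) eq_x eq_x eq_x).
  rewrite tri_binomial // !(triC23 _ y (pnorm i)) // !(triC12 y (pnorm i)) // !q0 !mulr0 !addr0.
  have /= <- := part_eval 3 yi; rewrite part0 // meval0 /tri.
  by rewrite big1 // => a' _; rewrite big1 // => b' _; rewrite big1 // => c' _; rewrite mxE mulr0.
have /eqP : F *+ 6 = 0.
  rewrite cubicE // big1 // => a _; rewrite big1 // => b _; rewrite big1 // => c _.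
  by rewrite -/d d0 mxE scale0r.
by rewrite -scaler_nat mscalerI (negbTE six_neq0).
Qed.

Lemma multiplicity_equation :
  exists2 i, p 0 i != 0 & multiplicity F p = mpoly_order (equation i).
Proof.
rewrite /multiplicity; case: pickP => [i pi|p0]; first by exists i.
case/eqP: p_neq0; apply/matrixP => a b; rewrite (ord1 a) mxE; apply/eqP.
by have := p0 b; move/negbT; rewrite negbK.
Qed.

(** A nonzero local equation of degree at most 3 has order at most 3, so order at least 2 means 2 or
    3. *)
Lemma multiplicity_singular :
  multiplicity F p = 2 \/ multiplicity F p = 3 <-> forall x, tri d (p 0) (p 0) x = 0.
Proof.
have [i pi ->] := multiplicity_equation.
rewrite -(part_singular pi); split=> [ord23|[part0 part1]].
  have ge2 : (1 < mpoly_order (equation i))%N by case: ord23 => ->.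
  have low j : (j < 2)%N -> part i j = 0.
    move=> lt2; apply: (lt_order_homog_eq0 (part_homog i) (equation_sum pi)).
      exact: leq_trans lt2 _.
    exact: leq_trans lt2 _.
  by split; apply: low.
have := order_homog_sum_lt4 six_neq0 (part_homog i) (equation_neq0 pi) (equation_sum pi).
have : (2 <= mpoly_order (equation i))%N.
  apply: (homog_eq0_le_order six_neq0 (part_homog i) (equation_neq0 pi) (equation_sum pi)).
  by case=> [|[|j]].
by case: (mpoly_order _) => [|[|[|[|j]]]] // _ _; [left | right].
Qed.

Lemma multiplicity_triple :
  multiplicity F p = 3 <-> forall x y, tri d (p 0) x y = 0.
Proof.
have [i pi ->] := multiplicity_equation.
rewrite -(part_triple pi); split=> [ord3|[part0 part1 part2]].
  have low j : (j < 3)%N -> part i j = 0.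
    move=> lt3; apply: (lt_order_homog_eq0 (part_homog i) (equation_sum pi)).
      by rewrite ord3.
    exact: leq_trans lt3 _.
  by split; apply: low.
have := order_homog_sum_lt4 six_neq0 (part_homog i) (equation_neq0 pi) (equation_sum pi).
have : (3 <= mpoly_order (equation i))%N.
  apply: (homog_eq0_le_order six_neq0 (part_homog i) (equation_neq0 pi) (equation_sum pi)).
  by case=> [|[|[|j]]].
by case: (mpoly_order _) => [|[|[|[|j]]]].
Qed.

End Multiplicity.

(** * Geometric meaning of the degenerate pairs *)

Section Geometry.
Variable k : closedFieldType.
Hypothesis six_neq0 : 6%:R != 0 :> k.
Variables (F S : {mpoly k[3]}).
Hypotheses (F3 : F \is 3.-homog) (F_neq0 : F != 0).
Hypotheses (S1 : S \is 1.-homog) (S_neq0 : S != 0).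
Implicit Types (p q : 'rV[k]_3).

Let d := form_tensor (cubic_coefs F).
Let u := linear_coefs S.
Let d_sym : symmetric_tensor d := form_tensor_sym _.

Lemma on_curveF p : on_curve F p = (tri d (p 0) (p 0) (p 0) == 0).
Proof. by rewrite -cubic_eval // -mulr_natr mulf_eq0 (negbTE six_neq0) orbF. Qed.

Lemma on_curveS p : on_curve S p = ((p *m u) 0 0 == 0).
Proof.
rewrite /on_curve /meval linear_mmap // mxE; congr (_ == 0).
by apply: eq_bigr => i _; rewrite mulrC.
Qed.

Lemma linear_coefs_neq0 : u != 0.
Proof.
apply: contraNneq S_neq0 => u0; rewrite (linear_formE S1) big1 // => i _.
by rewrite -/u u0 mxE scale0r.
Qed.

Lemma restrict_expand p q :
  restrict_to_line F p q *+ 6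
  = (tri d (p 0) (p 0) (p 0))%:P + (3%:R * tri d (p 0) (p 0) (q 0)) *: 'X
    + (3%:R * tri d (p 0) (q 0) (q 0)) *: 'X^2 + (tri d (q 0) (q 0) (q 0)) *: 'X^3.
Proof.
rewrite /restrict_to_line cubic_mmap // -/d.
pose lift_const (x : 'I_3 -> k) : 'I_3 -> {poly k} := polyC \o x.
have eq_h : (fun i => (p 0 i)%:P + q 0 i *: 'X) =1
    (fun i => lift_const (p 0) i + 'X * lift_const (q 0) i).
  by move=> i; rewrite /lift_const /= mulrC mul_polyC.
rewrite (eq_tri (frefl _) eq_h eq_h eq_h) tri_binomial; last exact: map_tensor_sym.
rewrite /lift_const !tri_map -!mul_polyC !polyCM (rmorph_nat polyC 3); ring.
Qed.

Lemma flat_line p q : p != 0 -> q != 0 -> ~ same_point p q ->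
  on_curve S p -> on_curve S q ->
  tri d (p 0) (p 0) (p 0) = 0 -> tri d (p 0) (p 0) (q 0) = 0 -> tri d (p 0) (q 0) (q 0) = 0 ->
  flex_tangent d u.
Proof.
rewrite !on_curveS => p0 q0 pq /eqP pL /eqP qL ppp ppq pqq.
have [i ui] : exists i, u i 0 != 0.
  by apply/existsP; apply: contraNT linear_coefs_neq0; rewrite negb_exists => /forallP u0;
     apply/eqP/matrixP => i j; rewrite (ord1 j) [RHS]mxE; apply/eqP; have := u0 i; rewrite negbK.
(* A coordinate vector off the line, as [u i 0] is nonzero; it completes [p] and [q] to a basis. *)
pose r : 'rV[k]_3 := delta_mx 0 i.
pose b : 'M[k]_3 := \matrix_(a, c) nth 0 [:: p 0 c; q 0 c; r 0 c] a.
have vb (v : 'rV[k]_3) : v *m b = v 0 o0 *: p + v 0 o1 *: q + v 0 o2 *: r.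
  by apply/matrixP => a c; rewrite (ord1 a) !mxE big_ord3 !mxE.
have dotD x y z : ((x *: p + y *: q + z *: r) *m u) 0 0
    = x * (p *m u) 0 0 + y * (q *m u) 0 0 + z * (r *m u) 0 0.
  by rewrite !mxE !big_ord3 !mxE; ring.
have rL : (r *m u) 0 0 = u i 0 by rewrite -rowE mxE.
have b0 : b o0 =1 p 0 by move=> c; rewrite mxE.
have b1 : b o1 =1 q 0 by move=> c; rewrite mxE.
have unitb : b \in unitmx.
  rewrite unitmxE unitfE; apply/negP => /det0P[v v_neq0]; rewrite vb => v_b.
  have v2 : v 0 o2 = 0.
    have := congr1 (fun w : 'rV_3 => (w *m u) 0 0) v_b.
    rewrite dotD pL qL rL !mulr0 !add0r mul0mx [RHS]mxE => /eqP.
    by rewrite mulf_eq0 (negbTE ui) orbF => /eqP.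
  have v0p : v 0 o0 *: p = - v 0 o1 *: q.
    by apply/eqP; rewrite scaleNr -addr_eq0 -[X in X == _]addr0 -[X in _ + X == _](scale0r r) -v2 v_b.
  have [v1|v1] := eqVneq (v 0 o1) 0.
    move/eqP: v0p; rewrite v1 oppr0 scale0r scaler_eq0 (negbTE p0) orbF => /eqP v0.
    case/negP: v_neq0; apply/eqP/matrixP => a c; rewrite (ord1 a) mxE.
    by move: c; apply: forall_ord3.
  apply: pq; exists (- v 0 o0 / v 0 o1); last first.
    by rewrite mulrC -scalerA scaleNr v0p scaleNr opprK scalerA mulVf ?scale1r.
  rewrite mulf_neq0 ?invr_eq0 // oppr_eq0; apply: contraNneq q0 => v0.
  move/eqP: v0p; rewrite v0 scale0r eq_sym scaler_eq0 oppr_eq0 (negbTE v1) /=.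
  by move=> /eqP ->.
have bu a : (b *m u) a 0 = (row a b *m u) 0 0.
  by rewrite -row_mul [RHS]mxE.
have row0 : row o0 b = p by apply/matrixP => a c; rewrite (ord1 a) !mxE.
have row1 : row o1 b = q by apply/matrixP => a c; rewrite (ord1 a) !mxE.
exists b => //; rewrite !bu row0 row1 !act_tri; split=> //.
- by rewrite (eq_tri (frefl d) b0 b0 b0).
- by rewrite (eq_tri (frefl d) b0 b0 b1).
- by rewrite (eq_tri (frefl d) b0 b1 b1).
Qed.

Lemma triple_tangent_flex : triple_tangent F S -> flex_tangent d u.
Proof.
move=> [_ [p [p0 /andP[pS pF] _ [q [q0 qS pq mup3]]]]].
have dvd3 : 'X^3 %| restrict_to_line F p q.
  have [->|nz] := eqVneq (restrict_to_line F p q) 0; first exact: dvdp0.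
  by rewrite -['X]subr0 -polyC0 -mup_geq // mup3.
have coef0 j : (j < 3)%N -> (restrict_to_line F p q *+ 6)`_j = 0.
  case/dvdpP: dvd3 => g ->; rewrite coefMn coefMXn => ->; exact: mul0rn.
have /andP[nz2 nz3] := two_three_neq0 six_neq0.
have c1 := coef0 1%N isT; have c2 := coef0 2%N isT.
move: c1 c2; rewrite restrict_expand !coefD !coefZ !coefC !coefX !coefXn /=.
rewrite !(mulr0, mulr1, addr0, add0r) => /eqP + /eqP.
rewrite !mulf_eq0 (negbTE nz3) /= => /eqP ppq /eqP pqq.
by apply: (flat_line p0 q0) => //; apply/eqP; rewrite -on_curveF.
Qed.

(** Polarization on the line turns vanishing at its points into vanishing of all coefficients with
    indices 0 and 1. *)
Lemma line_in_curve_flex : line_in_curve F S -> flex_tangent d u.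
Proof.
move=> LC; have [b unitb bu] := move_to_axis linear_coefs_neq0.
have onL (y : 'I_3 -> k) : y o2 = 0 -> tri (act b d) y y y = 0.
  move=> y2; pose p : 'rV[k]_3 := (\row_i y i) *m b.
  have eq_p : (fun a => \sum_i y i * b i a) =1 p 0.
    by move=> a; rewrite mxE; apply: eq_bigr => i _; rewrite mxE.
  rewrite tri_act (eq_tri (frefl d) eq_p eq_p eq_p).
  have [->|p_neq0] := eqVneq p 0.
    by rewrite /tri big1 // => i _; rewrite big1 // => j _; rewrite big1 // => l _; rewrite !mxE !mul0r.
  apply/eqP; rewrite -on_curveF; apply: LC => //.
  rewrite on_curveS -mulmxA bu mxE big1 // => i _; rewrite !mxE.
  by case: eqP => [->|]; rewrite ?y2 ?mul0r ?mulr0.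
have zero i j l : i != o2 -> j != o2 -> l != o2 -> act b d i j l = 0.
  move=> i2 j2 l2; apply: (mulfI six_neq0); rewrite mulr0 -tri_delta polarization; last exact: act_sym.
  by rewrite !onL ?(negbTE i2) ?(negbTE j2) ?(negbTE l2) ?addr0 //; ring.
exists b => //; rewrite bu; split; by [rewrite mxE | apply: zero].
Qed.

(** The one remaining coefficient e111 of the restriction decides: if it is zero the line lies in
    the curve, otherwise the restriction is a nonzero multiple of a cube and vanishes only at row 0
    of [b]. *)
Lemma flex_geometry : flex_tangent d u -> triple_tangent F S \/ line_in_curve F S.
Proof.
move=> [b unitb [bu0 bu1 d000 d001 d011]].
pose e := act b d; have e_sym : symmetric_tensor e by apply: act_sym.
have bu2 : (b *m u) o2 0 != 0.
  apply: contraNneq linear_coefs_neq0 => bu2; rewrite -[u](mulKmx unitb).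
  suff -> : b *m u = 0 by rewrite mulmx0.
  apply/matrixP => i j; rewrite (ord1 j) [RHS]mxE; move: i; exact: forall_ord3.
have coords p : exists2 y : 'rV[k]_3, p = y *m b & on_curve S p = (y 0 o2 == 0).
  exists (p *m invmx b); first by rewrite mulmxKV.
  rewrite on_curveS.
  have -> : p *m u = (p *m invmx b) *m (b *m u) by rewrite mulmxA mulmxKV.
  rewrite mxE big_ord3 bu0 bu1 !mulr0 !add0r.
  by rewrite mulf_eq0 (negbTE bu2) orbF.
have triE (y : 'rV[k]_3) : tri d ((y *m b) 0) ((y *m b) 0) ((y *m b) 0) = tri e (y 0) (y 0) (y 0).
  rewrite /e tri_act; have eq_y : (y *m b) 0 =1 (fun a => \sum_i y 0 i * b i a).
    by move=> a; rewrite mxE.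
  by rewrite (eq_tri (frefl d) eq_y eq_y eq_y).
have onF (y : 'rV[k]_3) : y 0 o2 = 0 -> on_curve F (y *m b) = (y 0 o1 ^+ 3 * e o1 o1 o1 == 0).
  move=> y2; rewrite on_curveF triE /tri !big_ord3 y2 !(tensor_sort e_sym) d000 d001 d011.
  by congr (_ == 0); ring.
have [e111|e111] := eqVneq (e o1 o1 o1) 0.
  right=> p _; have [y -> ->] := coords p; move=> /eqP y2.
  by rewrite onF // e111 mulr0.
left; pose p := row o0 b; pose q := row o1 b.
have pE : p = delta_mx 0 o0 *m b by rewrite -rowE.
have qE : q = delta_mx 0 o1 *m b by rewrite -rowE.
have inj_b (y z : 'rV[k]_3) : y *m b = z *m b -> y = z.
  by move/(congr1 (mulmx^~ (invmx b))); rewrite !mulmxK.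
have nz_row (i : 'I_3) : delta_mx 0 i *m b != 0 :> 'rV_3.
  apply: contraNneq (oner_neq0 k) => /(congr1 (mulmx^~ (invmx b))).
  by rewrite mulmxK // mul0mx => /matrixP/(_ 0 i); rewrite !mxE !eqxx => /eqP.
have onS (y : 'rV[k]_3) : y 0 o2 = 0 -> on_curve S (y *m b).
  by move=> y2; have [z /inj_b <- ->] := coords (y *m b); rewrite y2.
have deltaE (i j : 'I_3) : (delta_mx 0 i : 'rV[k]_3) 0 j = (j == i)%:R by rewrite mxE eqxx.
have qF : ~~ on_curve F q by rewrite qE onF deltaE // expr1n mul1r.
split.
  move=> LC; case/negP: qF; by apply: LC; rewrite qE ?nz_row // onS // deltaE.
exists p; split.
- by rewrite pE nz_row.
- by rewrite pE onS ?onF ?deltaE // expr0n mul0r eqxx.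
- move=> p' p'_neq0; have [y p'E ->] := coords p'; case/andP=> /eqP y2.
  rewrite p'E onF // mulf_eq0 (negbTE e111) orbF expf_eq0 /= => /eqP y1.
  exists (y 0 o0); last first.
    rewrite pE scalemxAl; congr (_ *m b); apply/matrixP => i j; rewrite (ord1 i) !mxE.
    by move: j; apply: forall_ord3; rewrite /= ?mulr1 ?mulr0.
  apply: contraNneq p'_neq0 => y0; rewrite p'E; apply/eqP.
  suff -> : y = 0 by rewrite mul0mx.
  by apply/matrixP => i j; rewrite (ord1 i) !mxE; move: j; apply: forall_ord3.
exists q; split.
- by rewrite qE nz_row.
- by rewrite qE onS // deltaE.
- move=> [c _]; rewrite qE pE scalemxAl => /inj_b /matrixP/(_ 0 o1); rewrite !mxE /= mulr0.
  by move/eqP; rewrite oner_eq0.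
have triD i j l : tri d (row i b 0) (row j b 0) (row l b 0) = e i j l.
  by rewrite /e act_tri; apply: eq_tri => // a; rewrite mxE.
have r6 : 6%:R *: restrict_to_line F p q = e o1 o1 o1 *: 'X^3.
  rewrite scaler_nat restrict_expand !triD d000 d001 d011 mulr0.
  by rewrite polyC0 !scale0r !add0r.
rewrite -[restrict_to_line F p q]scale1r -(mulVf six_neq0) -scalerA r6 scalerA -mul_polyC.
have c_neq0 : 6%:R^-1 * e o1 o1 o1 != 0 by rewrite mulf_neq0 ?invr_eq0.
rewrite mupMr ?rootC //.
by have /= := mup_XsubCX 3 (0 : k) 0; rewrite eqxx subr0.
Qed.

Lemma exists_basis p : p != 0 -> exists2 b : 'M[k]_3, b \in unitmx & row o2 b = p.
Proof.
move=> p_neq0; have pT : p^T != 0 by rewrite trmx_eq0.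
have [b unitb bp] := move_to_axis pT; exists (invmx b^T); first by rewrite unitmx_inv unitmx_tr.
rewrite rowE (_ : delta_mx 0 o2 = p *m b^T); first by rewrite mulmxK ?unitmx_tr.
by rewrite -[p]trmxK -trmx_mul bp; apply/matrixP => i j; rewrite !mxE (ord1 i) eqxx.
Qed.

Lemma degenerate_geometry : degenerate d u ->
  triple_tangent F S \/ line_in_curve F S \/ line_through_double_point F S \/ has_triple_point F.
Proof.
have row_neq0 (b : 'M[k]_3) i : b \in unitmx -> row i b != 0.
  move=> unitb; apply: contraTneq unitb => b0; rewrite unitmxE unitfE negbK.
  by rewrite (expand_det_row _ i) big1 // => j _; have /matrixP/(_ 0 j) := b0; rewrite !mxE => ->; rewrite mul0r.
have rowE0 (b : 'M[k]_3) i : row i b 0 =1 b i by move=> a; rewrite mxE.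
have span (b : 'M[k]_3) x : b \in unitmx -> exists y, x =1 (fun a => \sum_i y i * b i a).
  move=> unitb; pose y := (\row_i x i) *m invmx b; exists (y 0) => a.
  by have /matrixP/(_ 0 a) := mulmxKV unitb (\row_i x i); rewrite -/y !mxE.
case=> [/flex_geometry [tt|lc]|[b unitb [bu0 d00]]|[b unitb d2]]; [by left|by right; left| |].
  pose p := row o0 b; have p_neq0 := row_neq0 b o0 unitb.
  have pS : on_curve S p by rewrite on_curveS -row_mul mxE bu0.
  have sing x : tri d (p 0) (p 0) x = 0.
    have [y eq_x] := span b x unitb; rewrite (eq_tri (frefl d) (rowE0 _ _) (rowE0 _ _) eq_x).
    by rewrite tri_sum3 big1 // => i _; rewrite -act_tri d00 mulr0.
  (* The singular point on the line may have multiplicity 3, which is the last alternative. *)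
  right; right; have /(multiplicity_singular six_neq0 F3 F_neq0 p_neq0) [m2|m3] := sing.
    by left; exists p.
  by right; exists p.
right; right; right; exists (row o2 b); have p_neq0 := row_neq0 b o2 unitb; split=> //.
apply/(multiplicity_triple six_neq0 F3 F_neq0 p_neq0) => x y.
have [x' eq_x] := span b x unitb; have [y' eq_y] := span b y unitb.
rewrite (eq_tri (frefl _) (rowE0 _ _) eq_x eq_y) tri_sum2 big1 // => i _.
by rewrite tri_sum3 big1 ?mulr0 // => j _; rewrite -act_tri d2 mulr0.
Qed.

Lemma geometry_degenerate :
  triple_tangent F S \/ line_in_curve F S \/ line_through_double_point F S \/ has_triple_point F ->
  degenerate d u.
Proof.
case=> [/triple_tangent_flex|[/line_in_curve_flex|[[p [p_neq0 pS m2]]|[p [p_neq0 m3]]]]].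
- by move=> flex; apply: Or31.
- by move=> flex; apply: Or31.
- have [b unitb bp] := exists_basis p_neq0; apply: Or32.
  have sing : forall x, tri d (p 0) (p 0) x = 0.
    by apply/(multiplicity_singular six_neq0 F3 F_neq0 p_neq0); left.
  (* [exists_basis] puts the point in the last row; this permutation moves it to the first. *)
  pose w : 'M[k]_3 := mx3 [:: [:: 0; 0; 1]; [:: 0; 1; 0]; [:: 1; 0; 0]].
  have unitw : w \in unitmx.
    by rewrite unitmxE (_ : \det w = -1) ?unitrN1 // det_mx33 !mxE /=; ring.
  have row0 : row o0 (w *m b) = p.
    rewrite row_mul -bp [in RHS]rowE; congr (_ *m b); apply/matrixP => i j; rewrite (ord1 i) !mxE.
    by move: j; apply: forall_ord3.
  have wb0 : (w *m b) o0 =1 p 0 by move=> a; rewrite -row0 [RHS]mxE.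
  exists (w *m b); first by rewrite unitmx_mul unitw.
  split; first by move: pS; rewrite on_curveS -row0 -row_mul [X in X == 0]mxE => /eqP.
  by move=> i; rewrite act_tri (eq_tri (frefl d) wb0 wb0 (frefl _)) sing.
have [b unitb bp] := exists_basis p_neq0; apply: Or33; exists b => // i j.
have b2 : b o2 =1 p 0 by move=> a; rewrite -bp mxE.
rewrite act_tri (eq_tri (frefl d) b2 (frefl _) (frefl _)).
exact: (proj1 (multiplicity_triple six_neq0 F3 F_neq0 p_neq0) m3).
Qed.

End Geometry.

(** * Reducedness *)

Lemma mpoly_rmorph_eq n (R S : comNzRingType) (f g : {rmorphism {mpoly R[n]} -> S}) :
  (forall c, f c%:MP = g c%:MP) -> (forall i, f 'X_i = g 'X_i) -> f =1 g.
Proof.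
move=> eqC eqX p; rewrite [p]mpolyE !rmorph_sum; apply: eq_bigr => m _.
rewrite -mul_mpolyC !rmorphM /= eqC mpolyXE_id !rmorph_prod; congr (_ * _).
by apply: eq_bigr => i _; rewrite !rmorphXn /= eqX.
Qed.

Lemma muni_eq0 n (R : comNzRingType) (p : {mpoly R[n.+1]}) : muni p = 0 -> p = 0.
Proof.
move=> p0; apply/mpolyP => m0; rewrite mcoeff0.
pose trunc (m : 'X_{1..n.+1}) := [multinom m (widen_ord (leqnSn n) i) | i < n].
have [m_p|] := boolP (m0 \in msupp p); last exact: memN_msupp_eq0.
have := congr1 (fun q : {poly {mpoly R[n]}} => q`_(m0 ord_max)@_(trunc m0)) p0.
rewrite /= coef0 mcoeff0 muniE coef_sum raddf_sum /= (bigD1_seq m0) ?msupp_uniq //=.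
rewrite big1 => [|m ne_m].
  by rewrite !coefZ coefXn eqxx mulr1 mcoeffZ mcoeffX eqxx mulr1 addr0.
rewrite !coefZ coefXn; have [eq_max|] := eqVneq; last by rewrite mulr0 mcoeff0.
rewrite mulr1 mcoeffZ mcoeffX; case: eqP => [eq_m|]; last by rewrite mulr0.
case/eqP: ne_m; apply/mnmP => i; case: (unliftP ord_max i) => [j ->|->]; last exact/esym.
have /mnmP/(_ j) := eq_m; rewrite !mnmE.
by rewrite (_ : lift ord_max j = widen_ord (leqnSn n) j) //; apply: val_inj; rewrite /= /bump leqNgt ltn_ord.
Qed.

(** The left side is a ring morphism in [p] that fixes constants, hence evaluation at the images of
    the variables. *)
Lemma muni_eval n (R : comNzRingType) (p : {mpoly R[n.+1]}) (c : 'I_n -> R) t :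
  exists x, (map_poly (meval c) (muni p)).[t] = p.@[x].
Proof.
pose f : {rmorphism {mpoly R[n.+1]} -> R} := horner_eval t \o map_poly (meval c) \o @muni n R.
pose x i := f 'X_i; exists x; apply: (mpoly_rmorph_eq (f := f) (g := meval x)) => [a|i] /=.
  by rewrite muniC map_polyC /= /horner_eval hornerC mevalC mevalC.
by rewrite mevalXU.
Qed.

Lemma mpoly_zero_everywhere (k : closedFieldType) n (p : {mpoly k[n]}) :
  (forall x, p.@[x] = 0) -> p = 0.
Proof.
elim: n p => [|n IHn] p p0.
  rewrite [p]nvar0_mpolyC; have := p0 (fun=> 0); rewrite {1}[p]nvar0_mpolyC mevalC => ->.
  exact: mpolyC0.
apply/muni_eq0/polyP => j; rewrite coef0; apply: IHn => c.
have -> : ((muni p)`_j).@[c] = (map_poly (meval c) (muni p))`_j by rewrite coef_map.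
rewrite (_ : map_poly _ _ = 0) ?coef0 //; apply: poly_zero_everywhere => t.
by have [x ->] := muni_eval p c t.
Qed.

Lemma mpoly_ext (k : closedFieldType) n (p q : {mpoly k[n]}) :
  (forall x, p.@[x] = q.@[x]) -> p = q.
Proof.
move=> eq_pq; apply/eqP; rewrite -subr_eq0; apply/eqP/mpoly_zero_everywhere => x.
by rewrite mevalB eq_pq subrr.
Qed.

(** * Discriminants and transversal lines *)

Section BinaryCubics.
Variable R : comNzRingType.

(* The discriminant of the binary cubic (a, 3b, 3c, e), up to a factor -27. *)
Definition cubic_disc (a b c e : R) : R :=
  a ^+ 2 * e ^+ 2 - 6%:R * a * b * c * e + 4%:R * a * c ^+ 3 + 4%:R * b ^+ 3 * e
  - 3%:R * b ^+ 2 * c ^+ 2.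

(** Translating the variable by [t] preserves the differences of the roots. *)
Lemma cubic_disc_shift a b c e t :
  cubic_disc (a + 3%:R * t * b + 3%:R * t ^+ 2 * c + t ^+ 3 * e)
             (b + 2%:R * t * c + t ^+ 2 * e) (c + t * e) e
  = cubic_disc a b c e.
Proof. by rewrite /cubic_disc; ring. Qed.

End BinaryCubics.

(** Each root of [f] is a root of [h], and a nonzero discriminant makes the three roots distinct. *)
Lemma cubic_squarefree_dvd (k : closedFieldType) (a b c e : k) (f h g : {poly k}) n :
  f *+ 6 = a%:P + (3%:R * b) *: 'X + (3%:R * c) *: 'X^2 + e *: 'X^3 ->
  6%:R != 0 :> k -> e != 0 -> cubic_disc a b c e != 0 -> h ^+ n = f * g -> f %| h.
Proof.
move=> f6 six_neq0 e_neq0 disc_neq0 hfg.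
pose q := 6%:R *: f; have qE : q = a%:P + (3%:R * b) *: 'X + (3%:R * c) *: 'X^2 + e *: 'X^3.
  by rewrite /q scaler_nat.
have coefq j : q`_j = nth 0 [:: a; 3%:R * b; 3%:R * c; e] j.
  rewrite qE !coefD !coefZ coefC coefX !coefXn.
  by case: j => [|[|[|[|j]]]]; rewrite /= ?nth_nil ?(mulr0, mulr1, addr0, add0r).
have size_q : size q = 4%N.
  apply/eqP; rewrite eqn_leq; apply/andP; split.
    by apply/leq_sizeP => j; rewrite coefq; case: j => [|[|[|[|j]]]] //= _; rewrite nth_nil.
  by rewrite ltnNge; apply: contraNN e_neq0 => /leq_sizeP/(_ 3%N (leqnn _)); rewrite coefq /= => ->.
have lead_q : lead_coef q = e by rewrite lead_coefE size_q coefq.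
have [rs q_rs] := closed_field_poly_normal q.
have size_rs : size rs = 3%N.
  have := size_q; rewrite q_rs size_scale ?lead_coef_eq0 -?size_poly_eq0 ?size_q //.
  by rewrite size_prod_XsubC => -[].
have fq : f %| h = (q %| h) by rewrite /q dvdpZl.
rewrite fq q_rs lead_q dvdpZl //; apply: uniq_roots_dvdp.
  apply/allP => z z_rs; have fz : root f z.
    by rewrite -(rootZ _ _ six_neq0) -/q q_rs rootZ ?lead_q // root_prod_XsubC.
  have : root (h ^+ n) z by rewrite hfg rootM fz.
  rewrite /root horner_exp expf_eq0 => /andP[_] //.
rewrite uniq_rootsE; move: q_rs lead_q; case: rs size_rs => [|x [|y [|z []]]] //= _.
rewrite !big_cons big_nil mulr1 => q_rs lead_q; rewrite lead_q in q_rs.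
have vieta : [/\ a = - e * (x * y * z), 3%:R * b = e * (x * y + x * z + y * z)
    & 3%:R * c = - e * (x + y + z)].
  have q2 : q = (- e * (x * y * z))%:P + (e * (x * y + x * z + y * z)) *: 'X
     + (- e * (x + y + z)) *: 'X^2 + e *: 'X^3.
    rewrite q_rs -!mul_polyC !(polyCM, polyCN, polyCD); ring.
  have coefq2 j : q`_j = nth 0 [:: - e * (x * y * z); e * (x * y + x * z + y * z); - e * (x + y + z); e] j.
    rewrite q2 !coefD !coefZ coefC coefX !coefXn.
    by case: j => [|[|[|[|j]]]]; rewrite /= ?nth_nil ?(mulr0, mulr1, addr0, add0r).
  by split; [have := coefq2 0%N|have := coefq2 1%N|have := coefq2 2%N]; rewrite coefq.
case: vieta => aE bE cE.
(* Vieta's formulas give 3b and 3c; the factor 27 makes the discriminant an integral polynomial in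
   these. *)
have discE : 27%:R * cubic_disc a b c e
    = - e ^+ 4 * ((x - y) * (x - z) * (y - z)) ^+ 2.
  transitivity (27%:R * a ^+ 2 * e ^+ 2 - 18%:R * a * (3%:R * b) * (3%:R * c) * e
    + 4%:R * a * (3%:R * c) ^+ 3 + 4%:R * (3%:R * b) ^+ 3 * e - (3%:R * b) ^+ 2 * (3%:R * c) ^+ 2).
    by rewrite /cubic_disc; ring.
  by rewrite aE bE cE; ring.
have nz27 : 27%:R != 0 :> k.
  have /andP[_ nz3] := two_three_neq0 six_neq0.
  by rewrite (_ : 27%:R = 3%:R ^+ 3) ?expf_neq0 // -natrX.
have : 27%:R * cubic_disc a b c e != 0 by rewrite mulf_neq0.
rewrite discE mulf_eq0 negb_or => /andP[_]; rewrite expf_eq0 /= !mulf_eq0 !subr_eq0 !negb_or.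
by case/andP=> /andP[-> ->] ->.
Qed.

(** The discriminant of the cubic on the line through [v] and [o], in the parameter t of v + t o. *)
Definition pencil_disc (R : comNzRingType) (d : tensor R) v o : R :=
  cubic_disc (tri d v v v) (tri d v v o) (tri d v o o) (tri d o o o).

Section Transversal.
Variable k : closedFieldType.
Hypothesis six_neq0 : 6%:R != 0 :> k.
Implicit Types (d : tensor k) (u : 'cV[k]_3).

Definition transversal_line d :=
  exists v o : 'I_3 -> k, tri d o o o != 0 /\ pencil_disc d v o != 0.

Lemma transversal_act (b : 'M[k]_3) d : transversal_line (act b d) -> transversal_line d.
Proof.
move=> [v [o]]; rewrite /pencil_disc !tri_act => ovb.
by exists (fun a => \sum_i v i * b i a), (fun a => \sum_i o i * b i a).
Qed.

(* Along the pencil of lines through a point of x_2 = 0 off the curve, the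
   discriminant vanishes only to first order at the simple tangent x_2 = 0. *)
Lemma transversal_tangent d : symmetric_tensor d ->
  d o0 o0 o0 = 0 -> d o0 o0 o1 = 0 -> d o0 o1 o1 != 0 -> d o0 o0 o2 != 0 ->
  transversal_line d.
Proof.
move=> d_sym d000 d001 d011 d002; have /andP[nz2 nz3] := two_three_neq0 six_neq0.
(* The centre (s, 1, 0) lies on x_2 = 0, where the cubic takes the value d111 + 3 s d011; this [s]
   makes it nonzero. *)
pose s : k := if d o1 o1 o1 == 0 then 1 else 0.
pose v z : 'I_3 -> k := fun i => nth 0 [:: 1; 0; z] i.
pose o : 'I_3 -> k := fun i => nth 0 [:: s; 1; 0] i.
pose ooo := d o1 o1 o1 + 3%:R * s * d o0 o1 o1.
have ooo_neq0 : ooo != 0.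
  rewrite /ooo /s; have [->|d111] := eqVneq (d o1 o1 o1) 0.
    by rewrite add0r mulr1 mulf_neq0.
  by rewrite mulr0 mul0r addr0.
(* On the line through (1, 0, z) and the centre, the first three discriminant arguments are z aX, z
   bX and cX at z. Hence the discriminant is z E(z), with E(0) a nonzero multiple of d002 d011^3. *)
pose aX : {poly k} := (3%:R * d o0 o0 o2)%:P + (3%:R * d o0 o2 o2)%:P * 'X + (d o2 o2 o2)%:P * 'X^2.
pose bX : {poly k} := (2%:R * d o0 o1 o2 + 2%:R * s * d o0 o0 o2)%:P
  + (d o1 o2 o2 + s * d o0 o2 o2)%:P * 'X.
pose cX : {poly k} := (d o0 o1 o1)%:P
  + (d o1 o1 o2 + 2%:R * s * d o0 o1 o2 + s ^+ 2 * d o0 o0 o2)%:P * 'X.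
pose E : {poly k} := 'X * aX ^+ 2 * ooo%:P ^+ 2 - 6%:R%:P * 'X * aX * bX * cX * ooo%:P
  + 4%:R%:P * aX * cX ^+ 3 + 4%:R%:P * 'X^2 * bX ^+ 3 * ooo%:P - 3%:R%:P * 'X * bX ^+ 2 * cX ^+ 2.
have E0 : E.[0] = 12%:R * d o0 o0 o2 * d o0 o1 o1 ^+ 3.
  by rewrite /E /aX /bX /cX !hornerE /=; ring.
have E_neq0 : E != 0.
  apply: contraNneq (_ : E.[0] != 0) => [->|]; first by rewrite horner0.
  rewrite E0 (_ : 12%:R = 2%:R * 6%:R); last by rewrite -natrM.
  by rewrite !mulf_neq0 ?expf_neq0.
have /closed_nonrootP [z] : 'X * E != 0 by rewrite mulf_neq0 ?polyX_eq0.
rewrite /root hornerM hornerX => zE_neq0.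
have oooE : tri d o o o = ooo.
  by rewrite /tri !big_ord3 !(tensor_sort d_sym) /o /= d000 d001 /ooo; ring.
exists (v z), o; rewrite oooE; split=> //.
suff -> : pencil_disc d (v z) o = z * E.[z] by [].
rewrite /pencil_disc oooE /cubic_disc /E /aX /bX /cX !hornerE.
have -> : tri d (v z) (v z) (v z)
    = z * (3%:R * d o0 o0 o2 + 3%:R * d o0 o2 o2 * z + d o2 o2 o2 * z ^+ 2).
  by rewrite /tri !big_ord3 !(tensor_sort d_sym) /v /= d000 d001; ring.
have -> : tri d (v z) (v z) o = z * (2%:R * d o0 o1 o2 + 2%:R * s * d o0 o0 o2
    + (d o1 o2 o2 + s * d o0 o2 o2) * z).
  by rewrite /tri !big_ord3 !(tensor_sort d_sym) /v /o /= d000 d001; ring.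
have -> : tri d (v z) o o = d o0 o1 o1
    + (d o1 o1 o2 + 2%:R * s * d o0 o1 o2 + s ^+ 2 * d o0 o0 o2) * z.
  by rewrite /tri !big_ord3 !(tensor_sort d_sym) /v /o /= d000 d001; ring.
by rewrite /=; ring.
Qed.

Theorem degenerate_or_transversal d u : symmetric_tensor d -> u != 0 ->
  degenerate d u \/ transversal_line d.
Proof.
move=> d_sym u_neq0; have [b unitb bu] := move_to_axis u_neq0.
suff axis_case e : symmetric_tensor e -> degenerate e (axis k) \/ transversal_line e.
  have [degen|trans] := axis_case _ (act_sym b d_sym).
    by left; apply: (degenerate_act unitb); rewrite bu.
  by right; apply: transversal_act trans.
move=> {d d_sym u u_neq0 b unitb bu}; move: e.
apply: line_normal_form => [d E d_sym unitE E_axis [degen|trans]|d d_sym d000 d001|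
    d d_sym d000 d001 d011].
- by left; apply: (degenerate_act unitE); rewrite E_axis.
- by right; apply: transversal_act trans.
- have [d011|d011] := eqVneq (d o0 o1 o1) 0; first by left; apply: degenerate_double_root => //; left.
  have [d002|d002] := eqVneq (d o0 o0 o2) 0; first by left; apply: degenerate_double_root => //; right.
  by right; apply: transversal_tangent.
have [d111|d111] := eqVneq (d o1 o1 o1) 0; first by left; apply: degenerate_cube.
(* A sum of two nonzero cubes has distinct roots, so x_2 = 0 itself is transversal. *)
right; exists (fun a => (o0 == a)%:R), (fun a => (o1 == a)%:R).
rewrite /pencil_disc !tri_delta d001 d011; split=> //.
rewrite (_ : cubic_disc _ _ _ _ = (d o0 o0 o0 * d o1 o1 o1) ^+ 2); last by rewrite /cubic_disc; ring.
by rewrite expf_neq0 // mulf_neq0.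
Qed.

End Transversal.

Lemma cubic_disc_map (R S : comNzRingType) (f : {rmorphism R -> S}) a b c e :
  f (cubic_disc a b c e) = cubic_disc (f a) (f b) (f c) (f e).
Proof. by rewrite /cubic_disc !(rmorphB, rmorphD, rmorphM, rmorph1); ring. Qed.

Lemma pencil_disc_shift (R : comNzRingType) (d : tensor R) w o t : symmetric_tensor d ->
  pencil_disc d (fun i => w i + t * o i) o = pencil_disc d w o.
Proof.
move=> d_sym; rewrite /pencil_disc tri_binomial //; set z := fun i => _.
have -> : tri d z z o = tri d w w o + 2%:R * t * tri d w o o + t ^+ 2 * tri d o o o.
  by rewrite /z /tri !big_ord3 !(tensor_sort d_sym); ring.
have -> : tri d z o o = tri d w o o + t * tri d o o o.
  by rewrite /z /tri !big_ord3 !(tensor_sort d_sym); ring.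
exact: cubic_disc_shift.
Qed.

(* Divide by f, which is monic up to a unit: on every fiber where the
   discriminant does not vanish, the remainder is divisible by the squarefree
   cubic f, hence zero; so the remainder is zero. *)
Section FamilyOfCubics.
Variables (k : closedFieldType) (m : nat).
Hypothesis six_neq0 : 6%:R != 0 :> k.
Variables (f : {poly {mpoly k[m]}}) (a b c : {mpoly k[m]}) (e : k).
Hypotheses (e_neq0 : e != 0) (disc_neq0 : cubic_disc a b c e%:MP != 0).
Hypothesis f6 :
  f *+ 6 = a%:P + (3%:R * b) *: 'X + (3%:R * c) *: 'X^2 + e%:MP *: 'X^3.

Lemma size_family : size f = 4%N /\ 6%:R%:MP * lead_coef f = e%:MP.
Proof.
have six_poly : 6%:R%:MP != 0 :> {mpoly k[m]} by rewrite mpolyC_eq0.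
have coef6 j : (6%:R%:MP *: f)`_j = nth 0 [:: a; 3%:R * b; 3%:R * c; e%:MP] j.
  rewrite mpolyC_nat scaler_nat f6 !coefD !coefZ coefC coefX !coefXn.
  by case: j => [|[|[|[|j]]]]; rewrite /= ?nth_nil ?(mulr0, mulr1, addr0, add0r).
have size4 : size (6%:R%:MP *: f) = 4%N.
  apply/eqP; rewrite eqn_leq; apply/andP; split.
    by apply/leq_sizeP => j; rewrite coef6; case: j => [|[|[|[|j]]]] //= _; rewrite nth_nil.
  rewrite ltnNge; apply: contraNN e_neq0 => /leq_sizeP/(_ 3%N (leqnn _)); rewrite coef6 /= => /eqP.
  by rewrite mpolyC_eq0.
have size4' : size f = 4%N by rewrite -size4 size_scale.
split=> //; by have := coef6 3%N; rewrite coefZ lead_coefE size4'.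
Qed.

Lemma family_dvd_fiber h g n (x : 'I_m -> k) :
  h ^+ n = f * g -> (cubic_disc a b c e%:MP).@[x] != 0 ->
  map_poly (meval x) f %| map_poly (meval x) h.
Proof.
move=> hfg disc_x.
apply: (cubic_squarefree_dvd (a := a.@[x]) (b := b.@[x]) (c := c.@[x]) (e := e)
  (g := map_poly (meval x) g) (n := n)) => //.
- rewrite -raddfMn f6 !raddfD /= map_polyC !map_polyZ /= !mevalM (rmorph_nat (meval x) 3).
  by rewrite map_polyX !map_polyXn /= mevalC.
- by move: disc_x; rewrite cubic_disc_map /= mevalC.
by rewrite -rmorphXn hfg rmorphM.
Qed.

Lemma family_quotient h g n : h ^+ n = f * g -> exists q, h = f * q.
Proof.
move=> hfg; have [size4 lead6] := size_family.
(* This constant makes [s *: f] monic, so that division with remainder is available over [{mpoly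
   k[m]}]. *)
pose s : {mpoly k[m]} := (6%:R / e)%:MP.
have s_neq0 : s != 0 by rewrite mpolyC_eq0 mulf_neq0 ?invr_eq0.
have size_sf : size (s *: f) = 4%N by rewrite size_scale.
have [q [r [divE size_r]]] : exists q r, h = q * (s *: f) + r /\ (size r < 4)%N.
  exists (Pdiv.Ring.rdivp h (s *: f)), (Pdiv.Ring.rmodp h (s *: f)); split.
    apply: Pdiv.RingMonic.rdivp_eq.
    by rewrite monicE lead_coefZ /s mpolyCM mulrAC lead6 -mpolyCM mulfV.
  by rewrite -size_sf Pdiv.Ring.ltn_rmodp -size_poly_eq0 size_sf.
suff r0 : r = 0 by exists (s *: q); rewrite divE r0 addr0 -scalerAr mulrC -scalerAr.
apply/polyP => j; rewrite coef0; apply/eqP.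
(* The product with the discriminant vanishes at every point, which replaces a density argument. *)
suff /eqP : r`_j * cubic_disc a b c e%:MP = 0 by rewrite mulf_eq0 (negbTE disc_neq0) orbF.
apply: mpoly_zero_everywhere => x; rewrite mevalM.
have [->|disc_x] := eqVneq ((cubic_disc a b c e%:MP).@[x]) 0; first by rewrite mulr0.
have dvd_r : map_poly (meval x) f %| map_poly (meval x) r.
  have -> : r = h - q * (s *: f) by rewrite divE addrAC subrr add0r.
  rewrite rmorphB rmorphM /= dvdp_sub //; first exact: family_dvd_fiber hfg disc_x.
  by rewrite map_polyZ dvdp_mull // -mul_polyC dvdp_mull.
have lead_x : (lead_coef f).@[x] != 0.
  apply: contraNneq e_neq0 => lead0; have := congr1 (meval x) lead6.
  by rewrite mevalM lead0 mulr0 mevalC => <-.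
have size_x : size (map_poly (meval x) f) = 4%N by rewrite size_map_poly_id0.
have r_x : map_poly (meval x) r = 0.
  apply: contraTeq dvd_r => r_x; apply/negP => /(dvdp_leq r_x); rewrite size_x leqNgt.
  by rewrite (leq_ltn_trans (size_poly _ _)).
have -> : (r`_j).@[x] = (map_poly (meval x) r)`_j by rewrite coef_map.
by rewrite r_x coef0 mul0r.
Qed.

End FamilyOfCubics.

(** * Division by a cubic that has a transversal line *)

Section Divisibility.
Variable k : closedFieldType.
Hypothesis six_neq0 : 6%:R != 0 :> k.
Variable F : {mpoly k[3]}.
Hypothesis F3 : F \is 3.-homog.

Let d := form_tensor (cubic_coefs F).
Let d_sym : symmetric_tensor d := form_tensor_sym _.
Let i0 : 'I_2 := ord0.
Let i1 : 'I_2 := ord_max.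

(* The pencil of lines through the third basis vector. *)
Section Pencil.
Variables (b : 'M[k]_3).
Hypothesis unitb : b \in unitmx.

Let o : 'I_3 -> k := b o2.
Hypothesis o_off : tri d o o o != 0.

Let base (c : 'I_2 -> k) : 'I_3 -> k := fun l => c i0 * b o0 l + c i1 * b o1 l.

Let wX : 'I_3 -> {mpoly k[2]} := fun l => b o0 l *: 'X_i0 + b o1 l *: 'X_i1.
Let oX : 'I_3 -> {mpoly k[2]} := mpolyC 2 (R := k) \o o.
Let D := map_tensor (mpolyC 2 (R := k)) d.
Let ooo := tri d o o o.

(** The change of coordinates x = c_0 b_0 + c_1 b_1 + t b_2, read as a polynomial in t over
    k[c_0, c_1]. *)
Definition pencil : {mpoly k[3]} -> {poly {mpoly k[2]}} :=
  mmap (polyC \o mpolyC 2 (R := k)) (fun l => (wX l)%:P + 'X * (oX l)%:P).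

HB.instance Definition _ := GRing.RMorphism.on pencil.

Lemma pencil_eval P c t :
  (map_poly (meval c) (pencil P)).[t] = P.@[fun l => base c l + t * o l].
Proof.
pose f : {rmorphism {mpoly k[3]} -> k} := horner_eval t \o map_poly (meval c) \o pencil.
pose x : 'I_3 -> k := fun l => base c l + t * o l.
apply: (mpoly_rmorph_eq (f := f) (g := meval x)) => [a|i] /=.
  by rewrite /pencil mmapC /= map_polyC /horner_eval hornerC /= !mevalC.
rewrite /pencil mmapX mmap1U mevalXU /horner_eval rmorphD rmorphM /= !map_polyC map_polyX /=.
by rewrite hornerD hornerM hornerX !hornerC mevalD !mevalZ !mevalXU mevalC /x /base ![b _ i * _]mulrC.
Qed.

Lemma pencilF : pencil F *+ 6 =
  (tri D wX wX wX)%:P + (3%:R * tri D wX wX oX) *: 'X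
  + (3%:R * tri D wX oX oX) *: 'X^2 + ooo%:MP *: 'X^3.
Proof.
rewrite [LHS](cubic_mmap _ _ F3) -/d.
have DpE : map_tensor (polyC \o mpolyC 2 (R := k)) d =1 map_tensor polyC D.
  by move=> i; apply/matrixP => j l; rewrite !mxE.
rewrite (eq_tri DpE (frefl _) (frefl _) (frefl _)).
rewrite (@tri_binomial _ _ (polyC \o wX) (polyC \o oX) 'X); last exact/map_tensor_sym/map_tensor_sym.
rewrite -[ooo%:MP](tri_map (mpolyC 2 (R := k))) -/D -/oX.
rewrite (tri_map _ D wX wX wX) (tri_map _ D wX wX oX) (tri_map _ D wX oX oX) (tri_map _ D oX oX oX).
move: (tri D wX wX wX) (tri D wX wX oX) (tri D wX oX oX) (tri D oX oX oX) => A0 A1 A2 A3.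
by rewrite -!mul_polyC !polyCM (rmorph_nat polyC 3); ring.
Qed.

Lemma eval_disc c :
  (cubic_disc (tri D wX wX wX) (tri D wX wX oX) (tri D wX oX oX) ooo%:MP).@[c]
  = pencil_disc d (base c) o.
Proof.
pose ev : {rmorphism {mpoly k[2]} -> k} := meval c.
have evD : map_tensor ev D =1 d by move=> i; apply/matrixP => j l; rewrite !mxE /= mevalC.
have evw : ev \o wX =1 base c.
  by move=> l; rewrite /= mevalD !mevalZ !mevalXU /base ![b _ l * _]mulrC.
have evo : ev \o oX =1 o by move=> l; rewrite /= mevalC.
rewrite -[LHS]/(ev _) cubic_disc_map /pencil_disc.
rewrite -(tri_map ev D wX wX wX) -(tri_map ev D wX wX oX) -(tri_map ev D wX oX oX).
by rewrite (eq_tri evD evw evw evw) (eq_tri evD evw evw evo) (eq_tri evD evw evo evo) /= mevalC.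
Qed.

Hypothesis disc_neq0 : exists c, pencil_disc d (base c) o != 0.

Lemma pencil_dvd H G n : H ^+ n = F * G -> exists Q, H = F * Q.
Proof.
move=> HFG.
have [q Hq] : exists q, pencil H = pencil F * q.
  apply: (family_quotient six_neq0 o_off _ pencilF (g := pencil G) (n := n)).
    have [c] := disc_neq0; rewrite -eval_disc; by apply: contraNneq => ->; rewrite meval0.
  by rewrite -rmorphXn HFG rmorphM.
(* The coordinates of x in the basis [b]; substituting them undoes [pencil]. *)
pose l i : {mpoly k[3]} := \sum_j invmx b j i *: 'X_j.
pose Q := (map_poly (comp_mpoly [tuple l o0; l o1]) q).[l o2].
exists Q; apply: mpoly_ext => x; rewrite mevalM.
pose c : 'I_2 -> k := fun j => (tnth [tuple l o0; l o1] j).@[x]; pose t := (l o2).@[x].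
have x_eq : (fun a => base c a + t * o a) =1 x.
  have lE i : (l i).@[x] = ((\row_j x j) *m invmx b) 0 i.
    rewrite raddf_sum mxE; apply: eq_bigr => j _.
    by rewrite /= mevalZ mevalXU mxE mulrC.
  move=> a; have /matrixP/(_ 0 a) := mulmxKV unitb (\row_j x j).
  by rewrite [LHS]mxE [RHS]mxE big_ord3 => <-; rewrite /base /c /t /o !(tnth_nth 0) /= !lE.
have evalP P : P.@[x] = (map_poly (meval c) (pencil P)).[t].
  by rewrite pencil_eval; apply: meval_eq => a; rewrite x_eq.
rewrite !evalP Hq rmorphM hornerM; congr (_ * _); rewrite -evalP.
pose ev : {rmorphism {mpoly k[3]} -> k} := meval x.
rewrite -[RHS]/(ev Q) /Q -horner_map -map_poly_comp /=; congr (_.[_]).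
by apply: eq_map_poly => p /=; rewrite comp_mpoly_meval.
Qed.

End Pencil.

Theorem cubic_dvd_of_dvd_exp H G n : transversal_line d -> H ^+ n = F * G -> exists Q, H = F * Q.
Proof.
move=> [v [o [o_off disc_vo]]].
have o_neq0 : \row_i o i != 0 :> 'rV[k]_3.
  apply: contraNneq o_off => /rowP o0'; rewrite /tri big1 // => i _.
  by rewrite big1 // => j _; rewrite big1 // => a _; have := o0' i; rewrite !mxE => ->; rewrite !mul0r.
have [b unitb bo] := exists_basis o_neq0.
have b2 : b o2 =1 o by move=> a; have /rowP/(_ a) := bo; rewrite !mxE.
apply: (@pencil_dvd b unitb); first by rewrite (eq_tri (frefl d) b2 b2 b2).
pose y := (\row_i v i) *m invmx b.
(* The first two coordinates of [v] suffice, as adding a multiple of the centre does not change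
   [pencil_disc]. *)
exists (fun j => y 0 (if j == i0 then o0 else o1)); rewrite -(pencil_disc_shift _ _ (y 0 o2)) //.
have eq_v : (fun i => y 0 o0 * b o0 i + y 0 o1 * b o1 i + y 0 o2 * b o2 i) =1 v.
  by move=> a; have /rowP/(_ a) := mulmxKV unitb (\row_i v i); rewrite [LHS]mxE [RHS]mxE big_ord3 => <-.
by rewrite /pencil_disc /= (eq_tri (frefl d) eq_v eq_v eq_v) (eq_tri (frefl d) eq_v eq_v b2)
  (eq_tri (frefl d) eq_v b2 b2) (eq_tri (frefl d) b2 b2 b2).
Qed.

End Divisibility.

Lemma dhomog_eval_scale (R : comNzRingType) n e (p : {mpoly R[n]}) (t : R) x :
  p \is e.-homog -> p.@[fun l => t * x l] = t ^+ e * p.@[x].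
Proof.
move=> /dhomogP p_e; rewrite !mevalE mulr_sumr !big_seq; apply: eq_bigr => m m_p.
under eq_bigr => l _ do rewrite exprMn.
by rewrite big_split /= -expr_sum mulrCA -mdegE; congr (_ ^+ _ * _); exact: p_e.
Qed.

Section Homogenization.
Variables (k : closedFieldType) (i : 'I_3).
Implicit Types (h : {mpoly k[2]}) (F : {mpoly k[3]}).

(** Padded to degree [msize h], one above the degree of a nonzero [h]; the extra factor ['X_i]
    dehomogenizes to 1. *)
Definition homogenize h : {mpoly k[3]} :=
  \sum_(m <- msupp h) h@_m *: ('X_i ^+ (msize h - mdeg m) * \prod_j 'X_(lift i j) ^+ m j).

Lemma homogenize_eval h (x : 'I_3 -> k) : x i != 0 ->
  (homogenize h).@[x] = x i ^+ msize h * h.@[fun j => x (lift i j) / x i].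
Proof.
move=> xi; rewrite raddf_sum mevalE mulr_sumr !big_seq; apply: eq_bigr => m m_h /=.
rewrite mevalZ mulrCA; congr (_ * _).
rewrite mevalM rmorphXn /= mevalXU rmorph_prod.
have le_m : (mdeg m <= msize h)%N by exact/ltnW/msize_mdeg_lt.
under [in RHS]eq_bigr => j _ do rewrite exprMn exprVn.
rewrite big_split /= prodfV -expr_sum -mdegE -{2}(subnK le_m) exprD.
rewrite -mulrA; congr (_ * _); rewrite mulrCA mulfV ?expf_neq0 // mulr1.
by apply: eq_bigr => j _; rewrite rmorphXn /= mevalXU.
Qed.

Lemma dehomogenize_eval F y :
  (dehomogenize i F).@[y] = F.@[fun l => if unlift i l is Some j then y j else 1].
Proof.
rewrite comp_mpoly_meval; apply: meval_eq => l; rewrite tnth_mktuple.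
by case: unliftP => [j _|_]; rewrite ?mevalXU ?meval1.
Qed.

Lemma dehomogenize_eval_chart F e (x : 'I_3 -> k) : F \is e.-homog -> x i != 0 ->
  F.@[x] = x i ^+ e * (dehomogenize i F).@[fun j => x (lift i j) / x i].
Proof.
move=> F_e xi; rewrite dehomogenize_eval -(dhomog_eval_scale _ _ F_e); apply: meval_eq => l.
by case: unliftP => [j ->|->]; rewrite ?mulr1 // mulrCA mulfV ?mulr1.
Qed.

Lemma dehomogenize_homogenize h : dehomogenize i (homogenize h) = h.
Proof.
apply: mpoly_ext => y; rewrite dehomogenize_eval homogenize_eval unlift_none ?oner_neq0 //.
by rewrite expr1n mul1r; apply: meval_eq => j; rewrite liftK divr1.
Qed.

(** The relation holds where x_i is nonzero; a further factor x_i on both sides extends it to all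
    points, and a common power of ['X_i] and [homogenize h] puts it in the required form. *)
Lemma homogenize_dvd_exp F e h g n : F \is e.-homog -> h ^+ n = dehomogenize i F * g ->
  exists N G, ('X_i * homogenize h) ^+ N = F * G.
Proof.
(* This exponent balances the powers of x_i that come from [F] and from [homogenize g]. *)
move=> F_e hfg; pose r := (e + msize g)%N.
have key : 'X_i ^+ r.+1 * homogenize h ^+ n = F * ('X_i ^+ (msize h * n).+1 * homogenize g).
  apply: mpoly_ext => x; rewrite !mevalM !rmorphXn /= !mevalXU.
  have [->|xi] := eqVneq (x i) 0; first by rewrite !exprS !mul0r mulr0.
  rewrite !homogenize_eval // (dehomogenize_eval_chart F_e xi).
  set y := fun j => _; have /(congr1 (meval y)) := hfg; rewrite rmorphXn rmorphM /= => hfg_y.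
  rewrite exprMn hfg_y !exprS /r exprD exprM.
  move: (x i ^+ e) (x i ^+ msize g) ((x i ^+ msize h) ^+ n) (_.@[y]) (g.@[y]) => A B C f' g'.
  by ring.
pose A := homogenize h; pose B := 'X_i ^+ (msize h * n).+1 * homogenize g.
exists (r.+1 + n)%N, (B * ('X_i ^+ n * A ^+ r.+1)).
rewrite mulrA -key exprMn ['X_i ^+ (_ + _)]exprD [A ^+ (_ + _)]exprD.
move: ('X_i ^+ r.+1) ('X_i ^+ n) (A ^+ r.+1) (A ^+ n) => x1 x2 x3 x4.
by rewrite [x3 * x4]mulrC mulrACA.
Qed.

End Homogenization.

Theorem nonreduced_unstable (k : closedFieldType) (F S : {mpoly k[3]}) :
  6%:R != 0 :> k -> F \is 3.-homog -> S \is 1.-homog -> S != 0 ->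
  nonreduced F -> unstable F S.
Proof.
move=> six_neq0 F3 S1 S_neq0 [i [h [[n [g hfg]] not_dvd]]].
have [degen|trans] := degenerate_or_transversal six_neq0
    (form_tensor_sym (cubic_coefs F)) (linear_coefs_neq0 S1 S_neq0).
  exact: degenerate_unstable.
have [N [G HFG]] := homogenize_dvd_exp F3 hfg.
have [Q HFQ] := cubic_dvd_of_dvd_exp six_neq0 F3 trans HFG.
(* Dehomogenizing sends ['X_i] to 1 and [homogenize h] back to [h]. *)
case: not_dvd; exists (dehomogenize i Q).
have dehomM A B : dehomogenize i (A * B) = dehomogenize i A * dehomogenize i B.
  by rewrite /dehomogenize rmorphM.
rewrite -dehomM -HFQ dehomM dehomogenize_homogenize /dehomogenize comp_mpolyXU.
by rewrite -tnth_nth tnth_mktuple unlift_none mul1r.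
Qed.

Theorem proposition2p5 (k : closedFieldType)
    (char_not2 : 2%N \notin [pchar k]) (char_not3 : 3%N \notin [pchar k])
    (F S : {mpoly k[3]})
    (F_cubic : F \is 3.-homog) (F_neq0 : F != 0)
    (S_linear : S \is 1.-homog) (S_neq0 : S != 0) :
  unstable F S <->
  (triple_tangent F S \/
   line_in_curve F S \/
   line_through_double_point F S \/
   has_triple_point F \/
   nonreduced F).
Proof.
have six := six_neq0 char_not2 char_not3.
have u_neq0 := linear_coefs_neq0 S_linear S_neq0.
split=> [/(unstable_vanishing six) van|].
  have degen := vanishing_degenerate char_not2 char_not3
    (form_tensor_sym (cubic_coefs F)) u_neq0 van.
  have := degenerate_geometry six F_cubic F_neq0 S_linear S_neq0 degen.
  by case=> [|[|[|]]]; tauto.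
have to_degen := geometry_degenerate six F_cubic F_neq0 S_linear S_neq0.
case=> [?|[?|[?|[?|nonred]]]]; last exact: (nonreduced_unstable six).
all: apply: (degenerate_unstable six) => //; apply: to_degen; tauto.
Qed.
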